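(* Let $\mathbb M$ be an o-minimal structure with definable choice functions and let $U$ be an open definable subset of $M^n$. Then $U$ is a finite union of open definable sets each of which is definably homeomorphic, by a reordering of coordinates, to an open cell.
   Context: Cells are in the usual o-minimal sense (van den Dries); an open cell in $M^n$ is a cell of dimension $n$. Definable choice: for every definable family $\{X_a\}_{a\in A}$ of nonempty sets there is a definable $f$ with $f(a)\in X_a$ for all $a\in A$. *)

(* Defs.v *)
From HB Require Import structures.
From mathcomp Require Import all_boot all_order all_fingroup.
From mathcomp Require Import boolp classical_sets.

Set Implicit Arguments.
Unset Strict Implicit.
Unset Printing Implicit Defensive.

Import Order.TTheory.
Local Open Scope classical_set_scope.
Local Open Scope order_scope.

Section OMin.
Variables (d : Order.disp_t) (M : orderType d).

Definition pt n := 'I_n -> M.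

Definition init n (x : pt n.+1) : pt n := fun j => x (lift ord_max j).
Definition lastc n (x : pt n.+1) : M := x ord_max.
Definition tailc n (x : pt n.+1) : pt n := fun j => x (lift ord0 j).
Definition app_last n (y : pt n) (t : M) : pt n.+1 :=
  fun i => if unlift ord_max i is Some j then y j else t.
Definition cat_pt m n (a : pt m) (y : pt n) : pt (m + n) :=
  fun i => match split i with inl j => a j | inr k => y k end.
Definition fstc m n (z : pt (m + n)) : pt m := fun j => z (lshift n j).
Definition sndc m n (z : pt (m + n)) : pt n := fun k => z (rshift m k).

(* open intervals with endpoints in M u {-oo,+oo} (None = infinite end) *)
Definition open_itv (a b : option M) : set M :=
  [set t | (if a is Some a then is_true (a < t) else True) /\
           (if b is Some b then is_true (t < b) else True)].

Definition piece_set (p : M + (option M * option M)) : set M :=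
  match p with inl a => [set a] | inr ab => open_itv ab.1 ab.2 end.

Definition DLO_no_endpoints : Prop :=
  (forall a b : M, a < b -> exists c, a < c /\ c < b) /\
  (forall a : M, exists b c, b < a /\ a < c).

(* An o-minimal structure on (M,<) (van den Dries, Ch. 1):
   a family (S_n)_n of collections of subsets of M^n. *)
Unset Implicit Arguments.
Record ominimal_structure := OMin {
  Def : forall n, set (set (pt n));
  def_setT : forall n, Def n [set: pt n];
  def_setC : forall n (A : set (pt n)), Def n A -> Def n (~` A);
  def_setI : forall n (A B : set (pt n)), Def n A -> Def n B -> Def n (A `&` B);
  def_prodM : forall n (A : set (pt n)), Def n A -> Def n.+1 [set x | A (init x)];
  def_Mprod : forall n (A : set (pt n)), Def n A -> Def n.+1 [set x | A (tailc x)];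
  def_diag : forall n (i j : 'I_n), Def n [set x | x i = x j];
  def_proj : forall n (A : set (pt n.+1)),
      Def n.+1 A -> Def n [set y | exists t, A (app_last y t)];
  def_lt : Def 2 [set x | x ord0 < x ord_max];
  def_point : forall a : M, Def 1 [set x | x ord0 = a];
  def_ominimal : forall A : set (pt 1), Def 1 A ->
      exists s : seq (M + (option M * option M)),
        forall x : pt 1, A x <-> exists2 p, p \in s & piece_set p (x ord0)
}.
Set Implicit Arguments.

Variable S : ominimal_structure.

Definition definable_map m n (A : set (pt m)) (f : pt m -> pt n) : Prop :=
  Def S (m + n) [set z | A (fstc z) /\ sndc z = f (fstc z)].

Definition definable_choice : Prop :=
  forall m n (A : set (pt m)) (X : set (pt (m + n))),
    Def S m A -> Def S (m + n) X ->
    (forall a, A a -> exists y, X (cat_pt a y)) ->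
    exists f : pt m -> pt n, definable_map A f /\ forall a, A a -> X (cat_pt a (f a)).

Definition box n (a b : pt n) : set (pt n) :=
  [set y | forall i, a i < y i /\ y i < b i].
Definition open_set n (U : set (pt n)) : Prop :=
  forall x, U x -> exists a b, box a b x /\ box a b `<=` U.

Definition continuous_on n (C : set (pt n)) (f : pt n -> M) : Prop :=
  forall x, C x -> forall a b, a < f x -> f x < b ->
    exists lo hi, box lo hi x /\
      forall y, C y -> box lo hi y -> a < f y /\ f y < b.

Definition def_cont_fun n (C : set (pt n)) (f : pt n -> M) : Prop :=
  Def S n.+1 [set z | C (init z) /\ lastc z = f (init z)] /\ continuous_on C f.

(* Cells (van den Dries, Ch. 3), starting from the single point of M^0.
   [cell n s C]: C is an (i_1,...,i_n)-cell, s = [:: i_1; ...; i_n]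
   (false = 0: graph, true = 1: band). *)
Inductive cell : forall n, seq bool -> set (pt n) -> Prop :=
| cell_pt : cell [::] [set: pt 0]
| cell_graph n s (C : set (pt n)) (f : pt n -> M) :
    cell s C -> def_cont_fun C f ->
    cell (rcons s false) [set x | C (init x) /\ lastc x = f (init x)]
| cell_band n s (C : set (pt n)) (lo hi : option (pt n -> M)) :
    cell s C ->
    (if lo is Some f then def_cont_fun C f else True) ->
    (if hi is Some g then def_cont_fun C g else True) ->
    (forall x, C x -> match lo, hi with
                      | Some f, Some g => is_true (f x < g x)
                      | _, _ => True end) ->
    cell (rcons s true)
      [set x | C (init x) /\
               (if lo is Some f then is_true (f (init x) < lastc x) else True) /\
               (if hi is Some g then is_true (lastc x < g (init x)) else True)].

Definition open_cell n (C : set (pt n)) : Prop :=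
  exists s, cell s C /\ count id s = n.

End OMin.

Arguments ominimal_structure {d} M.
Arguments Def {d M} o n.

(* Main.v *)
Require Import Defs.
From HB Require Import structures.
From mathcomp Require Import all_boot all_order all_fingroup.
From mathcomp Require Import boolp classical_sets.

(** Every definable set of M^k is a finite union of open cells and of "thin" definable
    sets, on which forgetting some coordinate is injective; moreover any given definable
    functions are continuous on the open cells.  Given U open in M^n and X a subset of U
    determined by its first k coordinates, definable choice attaches to each point of X a
    box around it inside U, as a function of these k coordinates.  Over an open cell of
    M^k on which this choice is continuous, the boxes form an open cell inside U covering
    the corresponding part of X; over a thin set, X is determined by k - 1 coordinates
    after a reordering, and one concludes by induction on k, starting from X = U, k = n.

    The decomposition rests on the density of the continuity points of definable
    functions, which is proved by induction on the number of variables from the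
    monotonicity theorem.  For the fibrewise boundary A of a definable subset of M^(n+1),
    which has finite fibres, a definable function on A is then continuous at (x, y) for
    every y in A_x, for generic x: pick a bad branch y = b(x) definably, isolate it in its
    fibre definably, and make these choices continuous.  Applied to the successor function
    of A_x this yields, over a definably connected cell of generic points, uniformly
    finitely many continuous branches. *)

Set Implicit Arguments.
Unset Strict Implicit.
Unset Printing Implicit Defensive.

Import Order.TTheory.
Local Open Scope order_scope.
Local Open Scope classical_set_scope.

(** * Definability *)

Section Points.
Variables (d : Order.disp_t) (M : orderType d).

Lemma init_app n (x : pt M n) t : init (app_last x t) = x.
Proof. by apply/funext => j; rewrite /init /app_last liftK. Qed.

Lemma lastc_app n (x : pt M n) t : lastc (app_last x t) = t.
Proof. by rewrite /lastc /app_last unlift_none. Qed.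

Lemma app_init n (z : pt M n.+1) : app_last (init z) (lastc z) = z.
Proof.
apply/funext => i; rewrite /app_last.
by case: unliftP => [j ->|->].
Qed.

Lemma fstc_cat m n (a : pt M m) (b : pt M n) : fstc (cat_pt a b) = a.
Proof.
apply/funext => i; rewrite /fstc /cat_pt; case: splitP => j /= e.
  by congr a; apply: val_inj.
by move: (ltn_ord i); rewrite e ltnNge leq_addr.
Qed.

Lemma sndc_cat m n (a : pt M m) (b : pt M n) : sndc (cat_pt a b) = b.
Proof.
apply/funext => i; rewrite /sndc /cat_pt; case: splitP => j /= e.
  by move: (ltn_ord j); rewrite -e ltnNge leq_addr.
by congr b; apply: val_inj; apply/eqP; rewrite /= -(eqn_add2l m) e.
Qed.

Lemma pt0_eq (x y : pt M 0) : x = y.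
Proof. by apply/funext => -[]. Qed.

End Points.

Section Definability.
Variables (d : Order.disp_t) (M : orderType d) (S : ominimal_structure M).
Local Notation pt := (pt M).

Definition dset n (P : pt n -> Prop) : Prop := Def S n [set x | P x].

Lemma dset_ext n (P Q : pt n -> Prop) : (forall x, P x <-> Q x) -> dset P -> dset Q.
Proof.
by move=> PQ; rewrite /dset (_ : mkset P = mkset Q) //; apply/funext => x; apply/propext.
Qed.

Lemma dset_not n (P : pt n -> Prop) : dset P -> dset (fun x => ~ P x).
Proof. exact: def_setC. Qed.

Lemma dset_and n (P Q : pt n -> Prop) :
  dset P -> dset Q -> dset (fun x => P x /\ Q x).
Proof. exact: def_setI. Qed.

Lemma dset_or n (P Q : pt n -> Prop) :
  dset P -> dset Q -> dset (fun x => P x \/ Q x).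
Proof.
move=> dP dQ; apply: dset_ext (dset_not (dset_and (dset_not dP) (dset_not dQ))) => x.
by rewrite not_andE !notK.
Qed.

Lemma dset_imp n (P Q : pt n -> Prop) :
  dset P -> dset Q -> dset (fun x => P x -> Q x).
Proof.
move=> dP dQ; apply: dset_ext (dset_or (dset_not dP) dQ) => x.
by rewrite implyE.
Qed.

Lemma dset_cst n (Q : Prop) : dset (fun _ : pt n => Q).
Proof.
have dT : dset (fun _ : pt n => True) := def_setT _ _ S n.
have [q|q] := pselect Q; first by apply: dset_ext dT.
by apply: dset_ext (dset_not dT) => x; split.
Qed.

Lemma dset_ex n (Q : pt n -> M -> Prop) :
  dset (fun z : pt n.+1 => Q (init z) (lastc z)) -> dset (fun x => exists t, Q x t).
Proof.
move=> /def_proj; apply: dset_ext => x /=; split=> -[t] Qt; exists t;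
by move: Qt; rewrite /mkset init_app lastc_app.
Qed.

Lemma dset_ex2 n (P Q : pt n -> M -> Prop) :
  dset (fun z : pt n.+1 => P (init z) (lastc z) /\ Q (init z) (lastc z)) ->
  dset (fun x => exists2 t, P x t & Q x t).
Proof.
move=> /(@dset_ex _ (fun x t => P x t /\ Q x t)); apply: dset_ext => x.
by split=> [[t [Pt Qt]]|[t Pt Qt]]; exists t.
Qed.

Lemma dset_all n (Q : pt n -> M -> Prop) :
  dset (fun z : pt n.+1 => Q (init z) (lastc z)) -> dset (fun x => forall t, Q x t).
Proof.
move=> /dset_not dQ.
apply: dset_ext (dset_not (dset_ex (Q := fun x t => ~ Q x t) dQ)) => x.
split=> [H t|H [t]]; last exact.
by apply: contrapT => nQ; apply: H; exists t.
Qed.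

Lemma dset_all_fin n (I : finType) (Q : I -> pt n -> Prop) :
  (forall i, dset (Q i)) -> dset (fun x => forall i, Q i x).
Proof.
move=> dQ.
have: dset (fun x => forall i, i \in enum I -> Q i x).
  elim: (enum I) => [|i s IH]; first by apply: dset_ext (dset_cst n True).
  apply: dset_ext (dset_and (dQ i) IH) => x; split.
    by move=> [Qi Qs] j; rewrite in_cons => /orP[/eqP->|/Qs].
  by move=> H; split=> [|j js]; apply: H; rewrite in_cons ?eqxx // js orbT.
by apply: dset_ext => x; split=> [H i|H i _ //]; apply: H; rewrite mem_enum.
Qed.

Lemma dset_all_ord n k (Q : pt n -> 'I_k -> Prop) :
  (forall i, dset (fun x => Q x i)) -> dset (fun x => forall i, Q x i).
Proof. exact: (@dset_all_fin _ _ (fun i x => Q x i)). Qed.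

Lemma dset_cast m n (e : m = n) (P : pt m -> Prop) :
  dset P -> dset (fun x : pt n => P (x \o cast_ord e)).
Proof.
case: n / e; apply: dset_ext => x.
by rewrite (_ : x \o _ = x) //; apply/funext => i /=; rewrite cast_ord_id.
Qed.

Lemma dset_cylinder m n (P : pt n -> Prop) :
  dset P -> dset (fun z : pt (m + n) => P (sndc z)).
Proof.
move=> dP; elim: m => [|m IH].
  apply: dset_ext dP => x; rewrite (_ : sndc _ = x) //.
  by apply/funext => j; congr x; apply: val_inj.
apply: dset_ext (def_Mprod _ _ S _ _ IH) => x /=.
rewrite (_ : sndc (tailc x) = @sndc _ _ m.+1 n x) //.
by apply/funext => j; congr x; apply: val_inj.
Qed.

Lemma dset_proj m n (P : pt (m + n) -> Prop) : dset P ->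
  dset (fun x : pt n => exists z, P z /\ forall i, z (widen_ord (leq_addl m n) i) = x i).
Proof.
elim: m P => [|m IH] P dP.
  apply: dset_ext dP => x; split.
    by move=> Px; exists x; split=> // i; congr x; apply: val_inj.
  move=> [z [Pz zx]]; rewrite (_ : x = z) //; apply/funext => i.
  by rewrite -zx; congr z; apply: val_inj.
have e (z : pt (m + n).+1) i :
    z (widen_ord (leq_addl m.+1 n) i) = init z (widen_ord (leq_addl m n) i).
  by congr z; apply: val_inj; rewrite /= /bump leqNgt (leq_trans (ltn_ord i) (leq_addl m n)).
apply: dset_ext (IH _ (def_proj _ _ S _ _ dP)) => x; split.
  move=> [z [[t Pt] zx]]; exists (app_last z t); split=> // i.
  by rewrite e init_app.
move=> [z [Pz zx]]; exists (init z); split; last by move=> i; rewrite -e.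
by exists (lastc z); rewrite app_init.
Qed.

(** A point of [M^(m + n)] is read with the [n] base coordinates first and the [m] coordinates to be
    projected away last. Writing the sum as [m + n] lets it reduce in inductions on [m], at the
    price of casts along [addnC]. *)
Let base m n (i : 'I_n) : 'I_(m + n) := widen_ord (leq_addl m n) i.
Let fibre m n (j : 'I_m) : 'I_(m + n) := cast_ord (addnC n m) (rshift n j).

Let glue_base m n (x : pt n) (y : pt m) (i : 'I_n) :
  cat_pt x y (cast_ord (addnC m n) (base m i)) = x i.
Proof.
rewrite -[in RHS](fstc_cat x y) /fstc; congr cat_pt.
by apply: val_inj.
Qed.

Let glue_fibre m n (x : pt n) (y : pt m) (j : 'I_m) :
  cat_pt x y (cast_ord (addnC m n) (fibre n j)) = y j.
Proof.
rewrite -[in RHS](sndc_cat x y) /sndc; congr cat_pt.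
by apply: val_inj.
Qed.

Let dset_fibre m n (P : pt m -> Prop) :
  dset P -> dset (fun z : pt (m + n) => P (fun j => z (fibre n j))).
Proof. by move=> dP; apply: dset_cast (dset_cylinder n dP). Qed.

(** A copy of the reindexed coordinates is adjoined as [m] extra variables, tied to the old ones by
    diagonals, and then projected away. The map [s] may repeat or omit coordinates. *)
Lemma dset_reindex m n (s : 'I_m -> 'I_n) (P : pt m -> Prop) :
  dset P -> dset (fun x => P (fun j => x (s j))).
Proof.
move=> dP.
have dE : dset (fun z : pt (m + n) => forall j, z (fibre n j) = z (base m (s j))).
  by apply: dset_all_fin => j; apply: def_diag.
apply: dset_ext (dset_proj (dset_and (dset_fibre n dP) dE)) => x; split.
  move=> [z [[Pz ze] zx]].
  suff <- : (fun j => z (fibre n j)) = fun j => x (s j) by [].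
  by apply/funext => j; rewrite ze zx.
move=> Px; exists (fun i => cat_pt x (fun j => x (s j)) (cast_ord (addnC m n) i)).
split; last by move=> i; rewrite glue_base.
split; last by move=> j; rewrite glue_fibre glue_base.
by under eq_fun do rewrite glue_fibre.
Qed.

(* Definability of total functions and maps; partial ones are extended by junk values. *)
Definition deff n (f : pt n -> M) : Prop :=
  dset (fun z : pt n.+1 => lastc z = f (init z)).
Definition dmap n m (p : pt n -> pt m) : Prop := forall i, deff (fun x => p x i).

(** As for reindexing, with the extra variables now tied to the old ones by the graphs of the
    coordinates of [p]. *)
Lemma dset_comp m n (P : pt m -> Prop) (p : pt n -> pt m) :
  dset P -> dmap p -> dset (fun x => P (p x)).
Proof.
move=> dP dp.
have dE : dset (fun z : pt (m + n) =>
    forall j, z (fibre n j) = p (fun i => z (base m i)) j).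
  apply: dset_all_fin => j.
  pose s (i : 'I_n.+1) := if unlift ord_max i is Some k then base m k else fibre n j.
  apply: dset_ext (dset_reindex s (dp j)) => z.
  rewrite /lastc /s unlift_none (_ : init _ = fun i => z (base m i)) //.
  by apply/funext => i; rewrite /init liftK.
apply: dset_ext (dset_proj (dset_and (dset_fibre n dP) dE)) => x; split.
  move=> [z [[Pz ze] zx]].
  suff <- : (fun j => z (fibre n j)) = p x by [].
  apply/funext => j; rewrite ze; congr (p _ j).
  by apply/funext => i; rewrite zx.
move=> Px; exists (fun i => cat_pt x (p x) (cast_ord (addnC m n) i)).
split; last by move=> i; rewrite glue_base.
split; first by under eq_fun do rewrite glue_fibre.
by move=> j; under [in RHS]eq_fun do rewrite glue_base; rewrite glue_fibre.
Qed.

Lemma deff_ext n (f g : pt n -> M) : f =1 g -> deff f -> deff g.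
Proof. by move=> fg; apply: dset_ext => z; rewrite fg. Qed.

Lemma deff_coord n i : deff (fun x : pt n => x i).
Proof. exact: def_diag. Qed.

Lemma deff_cst n (c : M) : deff (fun _ : pt n => c).
Proof.
exact: (@dset_reindex 1 n.+1 (fun _ => ord_max) (fun y => y ord0 = c) (def_point _ _ S c)).
Qed.

Lemma dmap_coord n m (p : pt n -> pt m) i : dmap p -> deff (fun x => p x i).
Proof. exact. Qed.

Lemma dmap_id n : dmap (fun x : pt n => x).
Proof. by move=> i; apply: deff_coord. Qed.

Lemma dmap_cst n m (a : pt m) : dmap (fun _ : pt n => a).
Proof. by move=> i; apply: deff_cst. Qed.

Lemma dmap_init n m (p : pt n -> pt m.+1) : dmap p -> dmap (fun x => init (p x)).
Proof. by move=> dp i; apply: dp. Qed.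

Lemma dmap_fst n m k (p : pt n -> pt (m + k)) : dmap p -> dmap (fun x => fstc (p x)).
Proof. by move=> dp i; apply: dp. Qed.

Lemma dmap_snd n m k (p : pt n -> pt (m + k)) : dmap p -> dmap (fun x => sndc (p x)).
Proof. by move=> dp i; apply: dp. Qed.

Lemma dmap_cat n m k (p : pt n -> pt m) (q : pt n -> pt k) :
  dmap p -> dmap q -> dmap (fun x => cat_pt (p x) (q x)).
Proof. by move=> dp dq i; rewrite /cat_pt; case: (split i) => j. Qed.

Lemma dmap_app n m (p : pt n -> pt m) f :
  dmap p -> deff f -> dmap (fun x => app_last (p x) (f x)).
Proof. by move=> dp df i; rewrite /app_last; case: (unlift _ i) => [j|]. Qed.

(** The graph of the composite is the preimage of the graph of [f] under [(x, t) |-> (p x, t)]. *)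
Lemma deff_comp n m (f : pt m -> M) (p : pt n -> pt m) :
  deff f -> dmap p -> deff (fun x => f (p x)).
Proof.
move=> df dp.
have dq : dmap (fun z : pt n.+1 => app_last (p (init z)) (lastc z)).
  apply: dmap_app; last exact: deff_coord.
  move=> i; pose s (k : 'I_n.+1) : 'I_n.+2 :=
    if unlift ord_max k is Some l then lift ord_max (lift ord_max l) else ord_max.
  apply: dset_ext (dset_reindex s (dp i)) => z.
  rewrite /lastc /s unlift_none (_ : init _ = init (init z)) //.
  by apply/funext => l; rewrite /init liftK.
apply: dset_ext (dset_comp df dq) => z.
by rewrite lastc_app init_app.
Qed.

Lemma dmap_comp n m k (q : pt m -> pt k) (p : pt n -> pt m) :
  dmap q -> dmap p -> dmap (fun x => q (p x)).
Proof. by move=> dq dp i; apply: (deff_comp (dq i) dp). Qed.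

Lemma dset_eq n (f g : pt n -> M) : deff f -> deff g -> dset (fun x => f x = g x).
Proof.
move=> df dg; have da := dmap_app (@dmap_id n) dg.
apply: dset_ext (dset_comp df da) => x.
by rewrite lastc_app init_app; split.
Qed.

Lemma dset_eqv n m (p q : pt n -> pt m) : dmap p -> dmap q -> dset (fun x => p x = q x).
Proof.
move=> dp dq.
have dE : dset (fun x => forall i, p x i = q x i).
  by apply: dset_all_fin => i; apply: dset_eq.
by apply: dset_ext dE => x; split=> [H|-> //]; apply/funext.
Qed.

Lemma dset_lt n (f g : pt n -> M) : deff f -> deff g -> dset (fun x => f x < g x).
Proof.
move=> df dg; pose p x : pt 2 := fun i => if i == ord0 then f x else g x.
have dp : dmap p by move=> i; rewrite /p; case: (i == ord0).
have dl : dset (fun y : pt 2 => y ord0 < y ord_max) := def_lt _ _ S.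
by apply: dset_ext (dset_comp dl dp) => x.
Qed.

Lemma dset_le n (f g : pt n -> M) : deff f -> deff g -> dset (fun x => f x <= g x).
Proof.
move=> df dg; apply: dset_ext (dset_not (dset_lt dg df)) => x.
by rewrite leNgt; split=> /negP.
Qed.

Lemma dset_exv n m (Q : pt n -> pt m -> Prop) :
  dset (fun z : pt (n + m) => Q (fstc z) (sndc z)) -> dset (fun x => exists y, Q x y).
Proof.
move=> dQ.
have dE := @dset_cast _ _ (addnC n m) _ dQ.
apply: dset_ext (dset_proj dE) => x; split.
  move=> [z [Qz zx]]; exists (sndc (z \o cast_ord (addnC n m))).
  rewrite (_ : x = fstc (z \o cast_ord (addnC n m))) //.
  by apply/funext => i; rewrite -zx /=; congr z; apply: val_inj.
move=> [y Qxy]; exists (cat_pt x y \o cast_ord (addnC m n)); split.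
  rewrite (_ : _ \o _ = cat_pt x y) ?fstc_cat ?sndc_cat //.
  by apply/funext => i /=; congr cat_pt; apply: val_inj.
by move=> i; apply: glue_base.
Qed.

Lemma dset_allv n m (Q : pt n -> pt m -> Prop) :
  dset (fun z : pt (n + m) => Q (fstc z) (sndc z)) -> dset (fun x => forall y, Q x y).
Proof.
move=> /dset_not dQ.
apply: dset_ext (dset_not (dset_exv (Q := fun x y => ~ Q x y) dQ)) => x.
split=> [H t|H [t]]; last exact.
by apply: contrapT => nQ; apply: H; exists t.
Qed.

Lemma deff_if n (P : pt n -> Prop) (f g : pt n -> M) :
  dset P -> deff f -> deff g -> deff (fun x => if `[< P x >] then f x else g x).
Proof.
move=> dP df dg.
have di : dmap (fun z : pt n.+1 => init z) by apply/dmap_init/dmap_id.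
have dl : deff (fun z : pt n.+1 => lastc z) by apply: deff_coord.
have dPi := dset_comp dP di.
apply: dset_ext (dset_or (dset_and dPi df) (dset_and (dset_not dPi) dg)) => z.
case: asboolP => Pz; split; tauto.
Qed.

Definition def1 (P : M -> Prop) : Prop := dset (fun x : pt 1 => P (x ord0)).
Definition fun1 (f : M -> M) : Prop := deff (fun x : pt 1 => f (x ord0)).

Lemma dset_comp1 n (P : M -> Prop) (f : pt n -> M) :
  def1 P -> deff f -> dset (fun x => P (f x)).
Proof.
move=> dP df; pose p x : pt 1 := fun _ => f x.
have dp : dmap p by move=> i.
exact: dset_comp dP dp.
Qed.

Lemma deff_comp1 n (g : M -> M) (f : pt n -> M) :
  fun1 g -> deff f -> deff (fun x => g (f x)).
Proof.
move=> dg df; pose p x : pt 1 := fun _ => f x.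
have dp : dmap p by move=> i.
exact: deff_comp dg dp.
Qed.

(** The flag selects the order or its reverse, for arguments as well as for values, so that each
    one-sided argument is carried out only once. *)
Definition lto (b : bool) (x y : M) : bool := if b then x < y else y < x.

Lemma dset_lto n b (f g : pt n -> M) :
  deff f -> deff g -> dset (fun x => lto b (f x) (g x)).
Proof. by case: b => df dg; apply: dset_lt. Qed.

End Definability.


(* Proves definability of explicit formulas; under a quantifier the variables are read
   off the extended point with [init]/[lastc] (or [fstc]/[sndc]). *)
Create HintDb definable.

Ltac dtac :=
  cbv beta;
  lazymatch goal with
  | |- dset _ (fun _ => ?A) => exact: dset_cst
  | |- dset _ (fun x => @?A x /\ @?B x) => refine (@dset_and _ _ _ _ A B _ _); dtac
  | |- dset _ (fun x => @?A x \/ @?B x) => refine (@dset_or _ _ _ _ A B _ _); dtac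
  | |- dset _ (fun x => ~ @?A x) => refine (@dset_not _ _ _ _ A _); dtac
  | |- dset _ (fun x => is_true (@Order.lt _ _ (@?f x) (@?g x))) =>
      refine (@dset_lt _ _ _ _ f g _ _); dtac
  | |- dset _ (fun x => is_true (@Order.le _ _ (@?f x) (@?g x))) =>
      refine (@dset_le _ _ _ _ f g _ _); dtac
  | |- dset _ (fun x => is_true (lto _ (@?f x) (@?g x))) =>
      refine (@dset_lto _ _ _ _ _ f g _ _); dtac
  | |- dset _ (fun x => @eq (pt _ _) (@?f x) (@?g x)) =>
      refine (@dset_eqv _ _ _ _ _ f g _ _); dtac
  | |- dset _ (fun x => (@?f x) = (@?g x)) =>
      refine (@dset_eq _ _ _ _ f g _ _); dtac
  | |- dset _ (fun x => @ex (pt _ _) (@?Q x)) =>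
      refine (@dset_exv _ _ _ _ _ Q _); dtac
  | |- dset _ (fun x => exists t, @?Q x t) =>
      refine (@dset_ex _ _ _ _ Q _); dtac
  | |- dset _ (fun x => @ex2 _ (@?P x) (@?Q x)) =>
      refine (@dset_ex2 _ _ _ _ P Q _); dtac
  | |- dset _ (fun x => forall t : pt _ _, @?Q x t) =>
      refine (@dset_allv _ _ _ _ _ Q _); dtac
  | |- dset _ (fun x => forall t : ordinal _, @?Q x t) =>
      refine (@dset_all_ord _ _ _ _ _ Q _); intro; dtac
  | |- dset _ (fun x => (@?A x) -> (@?B x)) => refine (@dset_imp _ _ _ _ A B _ _); dtac
  | |- dset _ (fun x => forall t, @?Q x t) =>
      refine (@dset_all _ _ _ _ Q _); dtac
  | |- deff _ (fun _ => ?c) => exact: deff_cst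
  | |- deff _ (fun x => x ?i) => exact: deff_coord
  | |- deff _ (fun x => lastc (@?p x)) => refine (@dmap_coord _ _ _ _ _ p ord_max _); dtac
  | |- deff _ (fun x => @init ?d ?M ?a (@?p x) ?i) =>
      refine (@dmap_coord _ _ _ _ _ (fun x => @init d M a (p x)) i _); dtac
  | |- deff _ (fun x => @fstc ?d ?M ?a ?b (@?p x) ?i) =>
      refine (@dmap_coord _ _ _ _ _ (fun x => @fstc d M a b (p x)) i _); dtac
  | |- deff _ (fun x => @sndc ?d ?M ?a ?b (@?p x) ?i) =>
      refine (@dmap_coord _ _ _ _ _ (fun x => @sndc d M a b (p x)) i _); dtac
  | |- deff _ (fun x => ?q (@?p x) ?i) =>
      refine (@dmap_coord _ _ _ _ _ (fun x => q (p x)) i _); dtac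
  | |- deff _ (fun x => ?f (@?p x)) =>
      first [ refine (@deff_comp _ _ _ _ _ f p _ _) | refine (@deff_comp1 _ _ _ _ f p _ _) ];
      dtac
  | |- dmap _ (fun x => x) => exact: dmap_id
  | |- dmap _ (fun _ => ?c) => exact: dmap_cst
  | |- dmap _ (fun x => init (@?p x)) => refine (@dmap_init _ _ _ _ _ p _); dtac
  | |- dmap _ (fun x => fstc (@?p x)) => refine (@dmap_fst _ _ _ _ _ _ p _); dtac
  | |- dmap _ (fun x => sndc (@?p x)) => refine (@dmap_snd _ _ _ _ _ _ p _); dtac
  | |- dmap _ (fun x => app_last (@?p x) (@?f x)) =>
      refine (@dmap_app _ _ _ _ _ p f _ _); dtac
  | |- dmap _ (fun x => cat_pt (@?p x) (@?q x)) =>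
      refine (@dmap_cat _ _ _ _ _ _ p q _ _); dtac
  | |- dmap _ (fun x => ?q (@?p x)) =>
      refine (@dmap_comp _ _ _ _ _ _ q p _ _); dtac
  | |- dset _ (fun x => ?A (@?p x)) =>
      first [ refine (@dset_comp _ _ _ _ _ A p _ _) | refine (@dset_comp1 _ _ _ _ A p _ _) ];
      dtac
  | _ => try solve [ assumption | auto with definable ]
  end.

(** * One variable *)

Section OneVariable.
Variables (d : Order.disp_t) (M : orderType d) (HM : DLO_no_endpoints M).

Lemma lto_trans b : transitive (@lto d M b).
Proof. by case: b => y x z /=; [apply: lt_trans|move=> yx zy; apply: lt_trans yx]. Qed.

Lemma lto_irr b (x : M) : lto b x x = false.
Proof. by case: b; rewrite /lto ltxx. Qed.

Lemma ltoN b (x y : M) : lto (~~ b) x y = lto b y x.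
Proof. by case: b. Qed.

Lemma lto_nsym b (x y : M) : lto b x y -> ~ lto b y x.
Proof. by move=> xy yx; move: (lto_trans xy yx); rewrite lto_irr. Qed.

Lemma lto_total b (x y : M) : x <> y -> ~ lto b x y -> lto b y x.
Proof.
move=> /eqP xy /negP; case: b => /=; rewrite -leNgt le_eqVlt ?(negbTE xy) //.
  by rewrite eq_sym (negbTE xy).
Qed.

Lemma lto_le_trans b (x y z : M) : ~ lto b y x -> lto b y z -> lto b x z.
Proof. by case: b => /= /negP; rewrite -leNgt; [apply: le_lt_trans|move=> h k; apply: lt_le_trans k h]. Qed.

Lemma lto_lt_trans b (x y z : M) : lto b x y -> ~ lto b z y -> lto b x z.
Proof. by case: b => /= h /negP; rewrite -leNgt; [apply: lt_le_trans|move=> k; apply: le_lt_trans h]. Qed.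

Lemma lto_dense b (x y : M) : lto b x y -> exists2 z, lto b x z & lto b z y.
Proof. by case: b => /= /(proj1 HM) [z []]; exists z. Qed.

Lemma lt_dense (x y : M) : x < y -> exists2 z, x < z & z < y.
Proof. exact: (@lto_dense true). Qed.

Lemma lto_succ b (x : M) : exists y, lto b x y.
Proof. by have [y [z [yx xz]]] := proj2 HM x; case: b; [exists z|exists y]. Qed.

Lemma lto_max b (x y : M) :
  exists z, [/\ ~ lto b z x, ~ lto b z y & z = x \/ z = y].
Proof.
have [xy|/negP xy] := pselect (lto b x y); [exists y|exists x]; split;
  by [rewrite lto_irr|apply: lto_nsym|apply/negP|left|right].
Qed.

Definition germ b (x : M) (P : M -> Prop) : Prop :=
  exists2 u, lto b x u & forall t, lto b x t -> lto b t u -> P t.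

Lemma germ_and b x P Q : germ b x P -> germ b x Q -> germ b x (fun t => P t /\ Q t).
Proof.
move=> [u xu Pu] [v xv Qv]; have [w [wu wv ww]] := lto_max (~~ b) u v.
rewrite !ltoN in wu wv; exists w; first by case: ww => ->.
move=> t xt tw; split; [apply: Pu|apply: Qv] => //; exact: lto_lt_trans tw _.
Qed.

Lemma germ_mono b x (P Q : M -> Prop) :
  (forall t, lto b x t -> P t -> Q t) -> germ b x P -> germ b x Q.
Proof. by move=> PQ [u xu Pu]; exists u => // t xt tu; apply: PQ => //; apply: Pu. Qed.

Lemma germ_lt b x u : lto b x u -> germ b x (fun t => lto b t u).
Proof. by exists u. Qed.

Lemma germ_ex b x P : germ b x P -> exists2 t, lto b x t & P t.
Proof. by move=> [u xu Pu]; have [t xt tu] := lto_dense xu; exists t => //; apply: Pu. Qed.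

Definition decided b x P := germ b x P \/ germ b x (fun t => ~ P t).

Lemma germ_all b x (P : M -> Prop) : (forall t, lto b x t -> P t) -> germ b x P.
Proof. by move=> H; have [u xu] := lto_succ b x; exists u => // t xt _; apply: H. Qed.

Lemma decided_ext b x (P Q : M -> Prop) : (forall t, P t <-> Q t) -> decided b x P -> decided b x Q.
Proof.
by move=> PQ [] H; [left|right]; apply: germ_mono H => t _; rewrite PQ.
Qed.

Lemma decided_and b x P Q :
  decided b x P -> decided b x Q -> decided b x (fun t => P t /\ Q t).
Proof.
move=> [hP|hP] [hQ|hQ]; first by left; apply: germ_and.
- by right; apply: germ_mono hQ => t _ nQ [].
- by right; apply: germ_mono hP => t _ nP [].
- by right; apply: germ_mono hP => t _ nP [].
Qed.

Lemma decided_or b x P Q :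
  decided b x P -> decided b x Q -> decided b x (fun t => P t \/ Q t).
Proof.
move=> [hP|hP] [hQ|hQ]; last by right; apply: germ_mono (germ_and hP hQ) => t _; tauto.
- by left; apply: germ_mono hP => t _; left.
- by left; apply: germ_mono hP => t _; left.
- by left; apply: germ_mono hQ => t _; right.
Qed.

Lemma decided_cst b x (Q : Prop) : decided b x (fun _ => Q).
Proof. by have [q|q] := pselect Q; [left|right]; apply: germ_all. Qed.

Lemma decided_half b c x a : decided b x (lto c a).
Proof.
have [<-|nbc] := eqVneq c b.
  have [ax|ax] := pselect (lto c x a).
    right; apply: germ_mono (germ_lt ax) => t _; exact: lto_nsym.
  by left; apply: germ_all => t xt; apply: lto_le_trans xt.
have -> : c = ~~ b by case: b c nbc => -[].
have [ax|ax] := pselect (lto b x a).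
  by left; apply: germ_mono (germ_lt ax) => t _; rewrite ltoN.
right; apply: germ_all => t xt; rewrite ltoN; apply: lto_nsym.
exact: lto_le_trans xt.
Qed.

Lemma decided_piece b x (p : M + (option M * option M)) : decided b x (piece_set p).
Proof.
case: p => [a|[l u]] /=; last first.
  apply: decided_and.
    case: l => [l|]; [exact: (decided_half b true)|exact: decided_cst].
  case: u => [u|]; [exact: (decided_half b false)|exact: decided_cst].
(* The singleton of [a] is the intersection of the complements of the two open half-lines at [a]. *)
have D (P : M -> Prop) : decided b x P -> decided b x (fun t => ~ P t).
  by move=> [H|H]; [right|left] => //; apply: germ_mono H => t _ Pt; apply.
apply: decided_ext (decided_and (D _ (decided_half b true x a)) (D _ (decided_half b false x a))) => t /=.
split=> [[/negP + /negP]|-> ]; last by rewrite ltxx.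
by rewrite -!leNgt => ta at_; apply/eqP; rewrite eq_le ta.
Qed.

(** * Definable subsets of the line: germs, finiteness, suprema *)

Variable S : ominimal_structure M.

Lemma def1_pieces P : def1 S P -> exists s : seq (M + (option M * option M)),
  forall t, P t <-> exists2 p, p \in s & piece_set p t.
Proof.
move=> /def_ominimal [s H]; exists s => t.
exact: (H (fun _ => t)).
Qed.

(** Points and intervals are eventually true or eventually false on either side of [x], and this
    alternative passes to finite unions. *)
Lemma germ_dich P b x : def1 S P -> germ b x P \/ germ b x (fun t => ~ P t).
Proof.
move=> /def1_pieces[s H]; apply: decided_ext (fun t => iff_sym (H t)) _.
elim: s {P H} => [|p s IH].
  by apply: decided_ext (decided_cst b x False) => t; split=> // -[].
apply: decided_ext (decided_or (decided_piece b x p) IH) => t; split.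
  by move=> [pt|[q qs qt]]; [exists p|exists q] => //; rewrite in_cons ?eqxx // qs orbT.
by move=> [q]; rewrite in_cons => /orP[/eqP-> ?|qs qt]; [left|right; exists q].
Qed.

Definition fin (P : M -> Prop) := exists s : seq M, forall t, P t -> t \in s.
Definition on l u (P : M -> Prop) := forall t : M, l < t -> t < u -> P t.

(** If no interval among the pieces has a point, the pieces form a finite list. Otherwise a point
    [t0] of such an interval and the germ to its right supply one with both ends in [M]. *)
Lemma fin_or_itv P : def1 S P -> fin P \/ exists l u, l < u /\ on l u P.
Proof.
move=> /def1_pieces[s H].
suff: fin (fun t => exists2 p, p \in s & piece_set p t) \/
    exists l u, l < u /\ on l u (fun t => exists2 p, p \in s & piece_set p t).
  move=> [[r Hr]|[l [u [lu Hu]]]]; first by left; exists r => t /H/Hr.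
  by right; exists l, u; split=> // t lt tu; apply/H/Hu.
elim: s {P H} => [|p s [[r Hr]|[l [u [lu Hu]]]]].
- by left; exists [::] => t [].
- case: p => [a|[l u]].
    left; exists (a :: r) => t [p]; rewrite in_cons => /orP[/eqP-> /= ->|ps pt].
      by rewrite in_cons eqxx.
    by rewrite in_cons Hr ?orbT //; exists p.
  have [[t0 [lt0 t0u]]|no] := pselect (exists t, open_itv l u t); last first.
    left; exists r => t [p]; rewrite in_cons => /orP[/eqP-> lut|ps pt].
      by case: no; exists t.
    by apply: Hr; exists p.
  right.
  have: germ true t0 (open_itv l u).
    apply: germ_and.
      apply: germ_all => t; case: l lt0 => //= l; exact: lt_trans.
    case: u t0u => [u|] /= h; [exact: germ_lt|exact: germ_all].
  move=> [v t0v Hv]; exists t0, v; split=> // t lt tv.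
  by exists (inr (l, u)); [rewrite in_cons eqxx|apply: Hv].
- right; exists l, u; split=> // t lt tu.
  by have [q qs qt] := Hu t lt tu; exists q => //; rewrite in_cons qs orbT.
Qed.

(** The listed points are discarded one at a time: a point [x] inside the interval is avoided by
    passing to the part on the left of [x]. Density contradicts the empty list. *)
Lemma not_fin_itv P l u : l < u -> on l u P -> ~ fin P.
Proof.
move=> lu Pu [s]; elim: s l u P lu Pu => [|x s IH] l u P lu Pu Hs.
  have [t lt tu] := lto_dense (b := true) lu.
  by have := Hs t (Pu t lt tu).
have [/andP[lx xu]|xlu] := boolP ((l < x) && (x < u)).
  apply: (IH l x (fun t => P t /\ t < x)) => // [t lt tx|t [Pt tx]].
    by split=> //; apply: Pu => //; apply: lt_trans xu.
  by have := Hs t Pt; rewrite in_cons (lt_eqF tx).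
apply: (IH l u (fun t => P t /\ l < t < u)) => // [t lt tu|t [Pt ltu]].
  by split; [apply: Pu|rewrite lt].
have := Hs t Pt; rewrite in_cons => /orP[/eqP e|//].
by move: xlu; rewrite -e ltu.
Qed.

Lemma itv_of_not_fin P : def1 S P -> ~ fin P -> exists l u, l < u /\ on l u P.
Proof. by move=> /fin_or_itv[]. Qed.

(** The supremum for [lto b], hence the infimum when [b = false]; it need not belong to [P]. *)
Definition is_sup b (P : M -> Prop) s :=
  (forall t, P t -> ~ lto b s t) /\ (forall r, lto b r s -> exists2 t, P t & lto b r t).

Lemma is_sup_or b P Q s r : is_sup b P s -> is_sup b Q r ->
  exists q, is_sup b (fun t => P t \/ Q t) q.
Proof.
move=> [sP Ps] [rQ Qr]; have [q [qs qr qq]] := lto_max b s r; exists q; split.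
  move=> t [/sP h|/rQ h] qt; apply: h.
    exact: lto_le_trans qt.
  exact: lto_le_trans qt.
by move=> k kq; case: qq => e; rewrite {}e in kq;
  [have [t Pt kt] := Ps k kq|have [t Pt kt] := Qr k kq]; exists t => //; [left|right].
Qed.

Lemma sup_piece b (p : M + (option M * option M)) B :
  (exists t, piece_set p t) -> (forall t, piece_set p t -> ~ lto b B t) ->
  exists s, is_sup b (piece_set p) s.
Proof.
case: p => [a|[l u]] /=.
  move=> _ _; exists a; split=> [t ->|r ra]; first by rewrite lto_irr.
  by exists a.
move=> [t0 [lt0 t0u]] bd.
(* [e] is the end of the interval in direction [b]: a finite end is the supremum, an infinite one
   contradicts the bound [B]. *)
pose e := if b then u else l.
have step r x : lto b x r -> open_itv l u x ->
  (if e is Some c then is_true (lto b r c) else True) -> open_itv l u r.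
  rewrite /e /open_itv /=; case: b {bd e} => /= xr [lx xu]; split=> //.
  - by case: l lx {lt0} => //= l lx; apply: lt_trans xr.
  - by case: u xu {t0u} => //= u xu; apply: lt_trans xr _.
have ub t : open_itv l u t -> if e is Some c then is_true (lto b t c) else True.
  by rewrite /e; case: b {bd e step} => -[] /=; [case: u {t0u}|case: l {lt0}].
have t0i : open_itv l u t0 by [].
case: e step ub => [c|] step ub; last first.
  have [z [zB zt _]] := lto_max b B t0; have [r zr] := lto_succ b z.
  have /bd[] : open_itv l u r by apply: step t0i _ => //; apply: lto_le_trans zr.
  exact: lto_le_trans zr.
exists c; split=> [t /ub tc|r rc]; first exact: lto_nsym.
have [z [zr zt ze]] := lto_max b r t0.
have zc : lto b z c by case: ze => ->//; apply: ub.
have [x zx xc] := lto_dense zc; exists x; last exact: lto_le_trans zx.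
by apply: (step _ t0) => //; apply: lto_le_trans zx.
Qed.

(** Definable completeness: each nonempty piece has a supremum, and the largest of these serves for
    the union. *)
Lemma def1_sup b P B : def1 S P -> (exists t, P t) -> (forall t, P t -> ~ lto b B t) ->
  exists s, is_sup b P s.
Proof.
move=> /def1_pieces[s H] [t0 /H Pt0] bd.
have {bd} bd t : (exists2 p, p \in s & piece_set p t) -> ~ lto b B t by move/H/bd.
suff [r [r1 r2]] : exists r, is_sup b (fun t => exists2 p, p \in s & piece_set p t) r.
  by exists r; split=> [t /H/r1//|k /r2[t /H Pt kt]]; exists t.
elim: s {P H} t0 Pt0 bd => [|p s IH] t0 Pt0 bd; first by case: Pt0.
have E (P Q : M -> Prop) r : (forall t, P t <-> Q t) -> is_sup b P r -> is_sup b Q r.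
  by move=> PQ [h1 h2]; split=> [t /PQ/h1//|k /h2[t /PQ Qt kt]]; exists t.
have split_or t : (exists2 q, q \in p :: s & piece_set q t) <->
    piece_set p t \/ (exists2 q, q \in s & piece_set q t).
  split=> [[q]|[pt|[q qs qt]]].
  - by rewrite in_cons => /orP[/eqP->|qs qt]; [left|right; exists q].
  - by exists p => //; rewrite in_cons eqxx.
  - by exists q => //; rewrite in_cons qs orbT.
have bdp t : piece_set p t -> ~ lto b B t by move=> pt; apply: bd; apply/split_or; left.
have bds t : (exists2 q, q \in s & piece_set q t) -> ~ lto b B t.
  by move=> h; apply: bd; apply/split_or; right.
have [[t1 h1]|n1] := pselect (exists t, exists2 q, q \in s & piece_set q t); last first.
  have [|r hr] := sup_piece (p := p) _ bdp.
    by exists t0; move/split_or: Pt0 => [//|h]; case: n1; exists t0.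
  exists r; apply: E hr => t; rewrite split_or; split; first by left.
  by move=> [//|h]; case: n1; exists t.
have [r hr] := IH t1 h1 bds.
have [[t2 h2]|n2] := pselect (exists t, piece_set p t); last first.
  exists r; apply: E hr => t; rewrite split_or; split; first by right.
  by move=> [h|//]; case: n2; exists t.
have [k hk] := sup_piece (ex_intro _ t2 h2) bdp.
have [q hq] := is_sup_or hk hr; exists q; apply: E hq => t.
by rewrite split_or.
Qed.

End OneVariable.

(** * The monotonicity theorem *)

Section Monotonicity.
Variables (d : Order.disp_t) (M : orderType d) (HM : DLO_no_endpoints M).
Variables (S : ominimal_structure M) (HS : definable_choice S) (m0 : M).
Local Notation pt := (pt M).

(** Choice with a total function: where [P x] has no witness every value is accepted, so that the
    family [Q] is nonempty over the whole space. The point [m0] provides such a value. *)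
Lemma choicev n m (P : pt n -> pt m -> Prop) :
  dset S (fun z : pt (n + m) => P (fstc z) (sndc z)) ->
  exists2 f : pt n -> pt m, dmap S f & forall x, (exists y, P x y) -> P x (f x).
Proof.
move=> dP; pose Q (x : pt n) (y : pt m) := P x y \/ ~ exists y, P x y.
have dQ : Def S (n + m) [set z | Q (fstc z) (sndc z)].
  have dP' : dset S (fun z : pt (n + m + m) => P (fstc (fstc z)) (sndc z)).
    have dp : dmap S (fun z : pt (n + m + m) => cat_pt (fstc (fstc z)) (sndc z)) by dtac.
    by apply: dset_ext (dset_comp dP dp) => z; rewrite fstc_cat sndc_cat.
  apply: dset_or dP _; apply: dset_not.
  exact: (@dset_exv _ _ _ _ _ (fun z => P (fstc z)) dP').
have [x _|f [df Hf]] := HS (def_setT _ _ S n) dQ.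
  have [[y Py]|no] := pselect (exists y, P x y).
    by exists y; left; rewrite fstc_cat sndc_cat.
  by exists (fun _ => m0); right; rewrite fstc_cat.
exists f; last first.
  by move=> x ex; have := Hf x I; rewrite /= /Q fstc_cat sndc_cat => -[].
move=> i.
pose G (w : pt (n + m)) := [set: pt n] (fstc w) /\ sndc w = f (fstc w).
have dG : dset S G := df.
have dE : dset S (fun z : pt n.+1 => exists y : pt m, G (cat_pt (init z) y) /\ lastc z = y i).
  by dtac.
apply: dset_ext dE => z; rewrite /G; split.
  by move=> [y [[_]]]; rewrite fstc_cat sndc_cat => -> ->.
by move=> ->; exists (f (init z)); rewrite fstc_cat sndc_cat.
Qed.

Lemma choice1 n (P : pt n -> M -> Prop) :
  dset S (fun z : pt n.+1 => P (init z) (lastc z)) ->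
  exists2 f : pt n -> M, deff S f & forall x, (exists t, P x t) -> P x (f x).
Proof.
move=> dP.
have dQ : dset S (fun z : pt (n + 1) => P (fstc z) (sndc z ord0)).
  have dp : dmap S (fun z : pt (n + 1) => app_last (fstc z) (sndc z ord0)) by dtac.
  by apply: dset_ext (dset_comp dP dp) => z; rewrite init_app lastc_app.
have [f df Hf] := choicev (P := fun x y => P x (y ord0)) dQ.
exists (fun x => f x ord0) => // x [t Pt].
by apply: Hf; exists (fun _ => t).
Qed.

Lemma choice2 n (P : pt n -> M -> M -> Prop) :
  dset S (fun z : pt n.+2 => P (init (init z)) (lastc (init z)) (lastc z)) ->
  exists f g : pt n -> M, [/\ deff S f, deff S g &
    forall x, (exists t s, P x t s) -> P x (f x) (g x)].
Proof.
move=> dP.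
have dQ : dset S (fun z : pt n.+1 => exists s, P (init z) (lastc z) s).
  exact: (@dset_ex _ _ _ _ (fun z s => P (init z) (lastc z) s)).
have [f df Hf] := choice1 (P := fun x t => exists s, P x t s) dQ.
have dR : dset S (fun z : pt n.+1 => P (init z) (f (init z)) (lastc z)).
  have dp : dmap S (fun z : pt n.+1 => app_last (app_last (init z) (f (init z))) (lastc z)).
    by dtac.
  by apply: dset_ext (dset_comp dP dp) => z; rewrite !(init_app, lastc_app).
have [g dg Hg] := choice1 (P := fun x s => P x (f x) s) dR.
by exists f, g; split=> // x /Hf/Hg.
Qed.

Lemma choice_fun1 (P : M -> M -> Prop) :
  dset S (fun z : pt 2 => P (z ord0) (z ord_max)) ->
  exists2 f : M -> M, fun1 S f & forall x, (exists t, P x t) -> P x (f x).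
Proof.
move=> dP.
have dQ : dset S (fun z : pt 2 => P (init z ord0) (lastc z)).
  apply: dset_ext dP => z; rewrite /init /lastc (_ : lift _ _ = ord0) //.
  exact: val_inj.
have [f df Hf] := choice1 (P := fun x t => P (x ord0) t) dQ.
exists (fun t => f (fun _ => t)); last by move=> x /(Hf (fun _ => x)).
apply: deff_ext df => x /=; congr f.
by apply/funext => i; rewrite ord1.
Qed.

Variable f : M -> M.
Hypothesis df : fun1 S f.
Local Notation germ := (@germ d M).
Local Notation lto := (@lto d M).

(** If some value is taken infinitely often, its fibre contains an interval. Otherwise all fibres
    are finite, so the image is infinite and contains an interval. A definable section [g] of [f]
    over that interval has infinite range, and [f] is injective on an interval inside this range. *)
Lemma const_or_inj a b : a < b -> exists l u, [/\ l < u, on l u (fun t => a < t < b) &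
  (exists c, on l u (fun t => f t = c)) \/
  (forall s t, l < s < u -> l < t < u -> f s = f t -> s = t)].
Proof.
move=> ab.
have [[c nf]|Hf] := pselect (exists c, ~ fin (fun t => a < t /\ t < b /\ f t = c)).
  have [|l [u [lu H]]] := itv_of_not_fin HM (S := S) _ nf.
    by rewrite /def1; dtac.
  exists l, u; split=> //; first by move=> t lt tu; have [-> []] := H t lt tu.
  by left; exists c => t lt tu; have [_ []] := H t lt tu.
have {}Hf c : fin (fun t => a < t /\ t < b /\ f t = c).
  by apply: contrapT => h; apply: Hf; exists c.
(* A finite image would make the interval a finite union of finite fibres. *)
have nfin : ~ fin (fun y => exists t, a < t /\ t < b /\ f t = y).
  move=> [s Hs]; apply: (not_fin_itv HM (P := fun t => a < t /\ t < b /\ f t \in s) ab).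
    by move=> t lt tu; split=> //; split=> //; apply: Hs; exists t.
  elim: s {Hs} => [|c s [r Hr]]; first by exists [::] => t [_ []].
  have [q Hq] := Hf c; exists (q ++ r) => t [at_ [tb]]; rewrite in_cons mem_cat.
  by case/orP=> [/eqP e|ts]; apply/orP; [left; apply: Hq|right; apply: Hr].
have [|c [e [ce Hce]]] := itv_of_not_fin HM (S := S) _ nfin.
  by rewrite /def1; dtac.
have [|g dg Hg] := choice_fun1 (P := fun y t => a < t /\ t < b /\ f t = y).
  by dtac.
have {}Hg y : c < y -> y < e -> a < g y /\ g y < b /\ f (g y) = y.
  by move=> cy ye; apply: Hg; apply: Hce.
have nfin2 : ~ fin (fun t => exists y, c < y /\ y < e /\ g y = t).
  move=> [s Hs]; apply: (not_fin_itv HM (P := fun y => c < y /\ y < e) ce) => //.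
  exists (map f s) => y [cy ye]; have [_ [_ {1}<-]] := Hg y cy ye.
  by apply: map_f; apply: Hs; exists y.
have [|l [u [lu H]]] := itv_of_not_fin HM (S := S) _ nfin2.
  by rewrite /def1; dtac.
exists l, u; split=> //.
  by move=> t lt tu; have [y [cy [ye <-]]] := H t lt tu; have [-> [->]] := Hg y cy ye.
right=> s t /andP[ls su] /andP[lt tu].
have [y [cy [ye <-]]] := H s ls su; have [z [cz [ze <-]]] := H t lt tu.
by have [_ [_ ->]] := Hg y cy ye; have [_ [_ ->]] := Hg z cz ze => ->.
Qed.

(** Let [s] be the infimum of the points beyond [x] where the comparison with [f x] fails. If [f x]
    is below [f s], the comparison persists just after [s]; if not, it already fails just before
    [s], where the values are below [f s]. *)
Lemma locally_increasing e a b :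
  (forall x, a < x -> x < b -> germ false x (fun y => lto e (f y) (f x)) /\
                              germ true x (fun y => lto e (f x) (f y))) ->
  forall x z, a < x -> x < z -> z < b -> lto e (f x) (f z).
Proof.
move=> H x z ax xz zb; apply: contrapT => nxz.
pose E y := x < y /\ y < b /\ ~ lto e (f x) (f y).
have [| |t [xt _]|s [s1 s2]] := @def1_sup _ _ HM S false E x.
- by rewrite /def1 /E; dtac.
- by exists z.
- exact: (@lto_nsym _ _ true).
have [_ [u xu Hu]] := H x ax (lt_trans xz zb).
have xs : x < s.
  rewrite ltNge; apply/negP => sx.
  have [t [xt [tb nt]] tu] := s2 u (le_lt_trans sx xu).
  by apply: nt; apply: Hu.
have sz : s <= z by rewrite leNgt; apply/negP; apply: s1.
have [[v vs Hv] [w sw Hw]] := H s (lt_trans ax xs) (le_lt_trans sz zb).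
have [fs|fs] := pselect (lto e (f x) (f s)).
  have [t Et tw] := s2 w sw; have nts := s1 t Et; case: Et => xt [tb nt].
  have st : s < t.
    rewrite lt_neqAle leNgt; apply/andP; split; last exact/negP.
    by apply/eqP => est; apply: nt; rewrite -est.
  by apply: nt; apply: lto_trans fs (Hw _ st tw).
have [y ys [vy xy]] := germ_ex HM (germ_and (germ_lt (vs : lto false s v)) (germ_lt (xs : lto false s x))).
have fy := Hv y ys vy.
apply: (s1 y) => //; split=> //; split; first exact: lt_le_trans ys (ltW (le_lt_trans sz zb)).
by move=> fxy; apply: fs; apply: lto_trans fxy fy.
Qed.

(** * No interval consists of strict local extrema of an injective function *)

Section NoExtrema.
Variable e : bool.

(* [f] jumps down (for [lto e]) across some value [v] when crossing [x] in direction [b]. *)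
Let drop b x := exists v, germ (~~ b) x (fun y => ~ lto e (f y) v) /\
                          germ b x (fun y => lto e (f y) v).

Let def1_drop b : def1 S (drop b).
Proof. by rewrite /def1 /drop /germ; dtac. Qed.


(** [f] is injective with a strict local minimum, for [lto e], at every point between [a] and [c].
    The interval is traversed in direction [b], since both directions are needed for the
    contradiction. *)
Let all_min b a c :=
  (forall x y, lto b a x -> lto b x c -> lto b a y -> lto b y c -> f x = f y -> x = y) /\
  (forall x, lto b a x -> lto b x c ->
    germ b x (fun y => lto e (f x) (f y)) /\ germ (~~ b) x (fun y => lto e (f x) (f y))).

(** By the germ dichotomy it suffices to find points with a drop arbitrarily close to [c]. They
    occur because the values eventually fall below every value [f k] with [k] close to [c]. *)
Lemma germ_drop b a c : lto b a c -> all_min b a c -> germ (~~ b) c (drop b).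
Proof.
move=> ac [inj ext].
pose B x := forall y, lto b x y -> lto b y c -> lto e (f x) (f y).
have dB : def1 S B by rewrite /def1 /B; dtac.
have ga : germ (~~ b) c (fun x => lto b a x).
  have /germ_lt : lto (~~ b) c a by rewrite ltoN.
  by apply: germ_mono => t _; rewrite ltoN.
(* If [B] held near [c], the function would increase there, contradicting the strict minimum at a
   point [x] when compared with points just before [x]. *)
have [u uc Hu] : germ (~~ b) c (fun x => ~ B x /\ lto b a x).
  have [gB|gB] := germ_dich HM (~~ b) c dB; last exact: germ_and gB ga.
  have [w wc Hw] := germ_and gB ga; rewrite ltoN in wc.
  have [x wx xc] := lto_dense HM wc.
  have [Bx ax] : B x /\ lto b a x by apply: Hw; rewrite ltoN.
  have [_ gx] := ext x ax xc.
  have gw : germ (~~ b) x (fun y => lto b w y).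
    have /germ_lt : lto (~~ b) x w by rewrite ltoN.
    by apply: germ_mono => t _; rewrite ltoN.
  have [y yx [fxy wy]] := germ_ex HM (germ_and gx gw); rewrite ltoN in yx.
  have [By _] : B y /\ lto b a y by apply: Hw; rewrite ltoN //; apply: lto_trans xc.
  by have /lto_nsym := By x yx xc.
rewrite ltoN in uc.
have {}Hu x : lto b u x -> lto b x c -> lto b a x /\ exists y, [/\ lto b x y, lto b y c & lto e (f y) (f x)].
  move=> ux xc; have [nB ax] : ~ B x /\ lto b a x by apply: Hu; rewrite ltoN.
  split=> //; apply: contrapT => no; apply: nB => y xy yc.
  apply: contrapT => nf; apply: no; exists y; split=> //.
  apply: lto_total nf => exy; have exy' : x = y by apply: inj => //; apply: lto_trans xy.
  by move: xy; rewrite exy' lto_irr.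
(* Otherwise the values near [c] are not below [f k], and the supremum [s] of the points beyond [k]
   with value below [f k] lies before [c]. If [f s] is below [f k], some later point has a still
   smaller value; if not, the strict minimum at [s] keeps the values above [f k] just before [s]. *)
have below k : lto b u k -> lto b k c -> germ (~~ b) c (fun y => lto e (f y) (f k)).
  move=> uk kc; have [|//|[w wc Hw]] := @germ_dich _ _ HM S (fun y => lto e (f y) (f k)) (~~ b) c.
    by rewrite /def1; dtac.
  rewrite ltoN in wc.
  pose E y := lto b k y /\ lto b y c /\ lto e (f y) (f k).
  have [ak [y0 [ky0 y0c fy0]]] := Hu k uk kc.
  have [| |t [_ [tc _]]|s [s1 s2]] := @def1_sup _ _ HM S b E c.
  - by rewrite /def1 /E; dtac.
  - by exists y0.
  - exact: lto_nsym.
  have ks : lto b k s by apply: (lto_lt_trans ky0); apply: s1; split.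
  have sc : lto b s c.
    apply: contrapT => nsc; have [t [kt [tc ft]] wt] := s2 w (lto_lt_trans wc nsc).
    by apply: (Hw t) => //; rewrite ltoN.
  have us := lto_trans uk ks; have [as_ [y [sy yc fy]]] := Hu s us sc.
  have [fs|nfs] := pselect (lto e (f s) (f k)).
    case: (s1 y) => //; split; first exact: lto_trans sy.
    by split=> //; apply: lto_trans fs.
  have fks : lto e (f k) (f s).
    apply: lto_total nfs => esk; have es : s = k by apply: inj.
    by move: ks; rewrite es lto_irr.
  have [_ [v vs Hv]] := ext s as_ sc; rewrite ltoN in vs.
  have [t Et vt] := s2 v vs; have nst := s1 t Et; case: Et => kt [tc ft].
  have ts : lto b t s.
    by apply: lto_total nst => est; apply: nfs; rewrite est.
  have := Hv t; rewrite !ltoN => /(_ ts vt) /(lto_trans fks).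
  by move/lto_nsym.
(* Let [s] be the supremum of the points beyond [k] whose value is not below [f k]. Afterwards the
   values are below [f k], and so is [f s] by the strict minimum; hence [s] is approached by other
   such points, and the drop occurs at [s] across the value [f k]. *)
have dropped k : lto b u k -> lto b k c -> exists x, [/\ lto b k x, lto b x c & drop b x].
  move=> uk kc; have [w wc Hw] := below k uk kc; rewrite ltoN in wc.
  have [ak _] := Hu k uk kc; have [gk _] := ext k ak kc.
  pose E y := lto b k y /\ lto b y c /\ ~ lto e (f y) (f k).
  have [| |t [_ [tc _]]|s [s1 s2]] := @def1_sup _ _ HM S b E c.
  - by rewrite /def1 /E; dtac.
  - have [y ky [fy yc]] := germ_ex HM (germ_and gk (germ_lt kc)).
    by exists y; split=> //; split=> //; apply: lto_nsym.
  - exact: lto_nsym.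
  have ks : lto b k s.
    have [y ky [fy yc]] := germ_ex HM (germ_and gk (germ_lt kc)).
    by apply: (lto_lt_trans ky); apply: s1; split=> //; split=> //; apply: lto_nsym.
  have sc : lto b s c.
    apply: contrapT => nsc; have [t [kt [tc ft]] wt] := s2 w (lto_lt_trans wc nsc).
    by apply: ft; apply: Hw => //; rewrite ltoN.
  have right_ : germ b s (fun y => lto e (f y) (f k)).
    exists c => // t st tc; apply: contrapT => nf; apply: (s1 t) => //.
    by split=> //; apply: lto_trans st.
  have as_ := lto_trans ak ks; have [gs _] := ext s as_ sc.
  have fs : lto e (f s) (f k).
    apply: contrapT => nfs.
    have [y sy [fy fsy]] := germ_ex HM (germ_and right_ gs).
    by apply: nfs; apply: lto_trans fy.
  exists s; split=> //; exists (f k); split=> //.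
  have [|[v vs Hv]|//] := @germ_dich _ _ HM S (fun y => lto e (f y) (f k)) (~~ b) s.
    by rewrite /def1; dtac.
  rewrite ltoN in vs.
  have [t Et vt] := s2 v vs; have nst := s1 t Et; case: Et => kt [tc ft].
  have ts : lto b t s.
    by apply: lto_total nst => est; apply: ft; rewrite -est.
  by case: ft; apply: Hv; rewrite ltoN.
have [//|[w wc Hw]] := germ_dich HM (~~ b) c (def1_drop b).
rewrite ltoN in wc.
have [k kc [wk uk]] := germ_ex HM (germ_and (germ_lt (b := ~~ b) (x := c) (u := w) ltac:(by rewrite ltoN))
  (germ_lt (b := ~~ b) (x := c) (u := u) ltac:(by rewrite ltoN))).
rewrite !ltoN in kc wk uk.
have [x [kx xc Dx]] := dropped k uk kc.
case: (Hw x) => //; rewrite ltoN //.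
exact: lto_trans kx.
Qed.

(** Applied in both directions, [germ_drop] yields a point [x] with a drop across [v] to the right
    and a drop across [v'] to the left. The values on the left give [v] below [v'], those on the
    right give the reverse. *)
Lemma not_all_min a c : a < c -> ~ all_min true a c.
Proof.
move=> ac H; have [u uc Hu] := germ_drop (b := true) ac H.
have [w [wa wu we]] := lto_max true a u.
have wc : w < c by case: we => ->.
have aw : a <= w by rewrite leNgt; apply/negP.
have uw : u <= w by rewrite leNgt; apply/negP.
case: H => inj ext.
have H' : all_min false c w.
  split=> [x y xc wx yc wy|x xc wx].
    by apply: inj => //; apply: le_lt_trans aw _.
  by have [] := ext x (le_lt_trans aw wx) xc.
have [x wx [Dx xc]] := germ_ex HM (germ_and (germ_drop (b := false) wc H') (germ_lt (wc : lto true w c))).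
have [v [g1 g2]] := Hu x xc (le_lt_trans uw wx).
case: Dx => v' [g3 g4].
have [y _ [y1 y2]] := germ_ex HM (germ_and g1 g4).
have [z _ [z1 z2]] := germ_ex HM (germ_and g2 g3).
have vv' := lto_le_trans y1 y2.
by apply: z2; apply: lto_trans z1 vv'.
Qed.

End NoExtrema.

(** On a subinterval the comparison of [f x] with the nearby values is uniform on each side of [x].
    If both sides agree, every point is a strict local extremum, which is impossible; if they
    differ, [f] is locally, hence globally, monotone. *)
Lemma inj_monotone a b : a < b ->
  (forall s t, a < s < b -> a < t < b -> f s = f t -> s = t) ->
  exists e l u, [/\ l < u, on l u (fun t => a < t < b) &
    forall x z, l < x -> x < z -> z < u -> lto e (f x) (f z)].
Proof.
move=> ab inj.
have side s a' b' : a' < b' -> on a' b' (fun t => a < t < b) ->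
    exists e u, [/\ a' < u, u <= b' & on a' u (fun x => germ s x (fun y => lto e (f x) (f y)))].
  move=> ab' sub.
  have [|[u au Hu]|[u au Hu]] := @germ_dich _ _ HM S
      (fun x => germ s x (fun y => lto true (f x) (f y))) true a'.
  - by rewrite /def1 /germ; dtac.
  - exists true, (Order.min u b'); rewrite lt_min (au : a' < u) ab' ge_min lexx orbT; split=> // t at_.
    by rewrite lt_min => /andP[tu _]; apply: Hu.
  exists false, (Order.min u b'); rewrite lt_min (au : a' < u) ab' ge_min lexx orbT; split=> // t at_.
  rewrite lt_min => /andP[tu tb]; have {}Hu := Hu t at_ tu.
  have [|//|g] := @germ_dich _ _ HM S (fun y => lto true (f t) (f y)) s t.
    by rewrite /def1; dtac.
  have nei : germ s t (fun y => a' < y < b').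
    by case: (s); [exists b'|exists a'] => // y /= h1 h2; apply/andP; split=> //;
      [apply: lt_trans h1|apply: lt_trans tb].
  apply: germ_mono (germ_and g nei) => y ty [nf /andP[ay yb]].
  apply: (@lto_total _ _ true) nf => fe.
  have ety : t = y by apply: inj => //; apply: sub.
  by move: ty; rewrite ety lto_irr.
have sub0 : on a b (fun t => a < t < b) by move=> t h1 h2; apply/andP.
have [e1 [u1 [au1 u1b H1]]] := side true a b ab sub0.
have sub1 : on a u1 (fun t => a < t < b).
  by move=> t at_ tu; rewrite at_ (lt_le_trans tu u1b).
have [e2 [u2 [au2 u2u1 H2]]] := side false a u1 au1 sub1.
have sub2 : on a u2 (fun t => a < t < b).
  by move=> t at_ tu; apply: sub1 => //; apply: lt_le_trans u2u1.
have {}H1 x : a < x -> x < u2 -> germ true x (fun y => lto e1 (f x) (f y)).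
  by move=> ax xu; apply: H1 => //; apply: lt_le_trans u2u1.
have [e12|ne] := eqVneq e2 e1.
  case: (@not_all_min e1 a u2 au2); split.
    by move=> x y ax xu ay yu; apply: inj; apply: sub2.
  by move=> x ax xu; split; [apply: H1|rewrite -e12; apply: H2].
exists e1, a, u2; split=> //; apply: locally_increasing => x ax xu; split; last exact: H1.
have -> : e1 = ~~ e2 by case: e1 e2 ne {H1 H2} => -[].
by apply: germ_mono (H2 x ax xu) => y _; rewrite ltoN.
Qed.

(** Continuity at one point of the line, as a formula with quantifiers over [M] only. *)
Definition cont1 (t : M) := forall p q, p < f t -> f t < q ->
  exists l u, l < t /\ t < u /\ forall y, l < y -> y < u -> p < f y /\ f y < q.

(** The range is infinite, so it contains an interval. Between the preimages of two points of that
    interval, [f] skips no value and therefore has no jumps. *)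
Lemma monotone_cont e a b : a < b ->
  (forall x z, a < x -> x < z -> z < b -> lto e (f x) (f z)) ->
  exists l u, [/\ l < u, on l u (fun t => a < t < b) & on l u cont1].
Proof.
move=> ab mono.
have inj x y : a < x -> x < b -> a < y -> y < b -> f x = f y -> x = y.
  move=> ax xb ay yb fxy; case: (ltgtP x y) => // h; [have := mono x y ax h yb|have := mono y x ay h xb];
  by rewrite fxy lto_irr.
have nfin : ~ fin (fun y => exists t, a < t /\ t < b /\ f t = y).
  move=> [s Hs].
  have [|g dg Hg] := choice_fun1 (P := fun y t => a < t /\ t < b /\ f t = y); first by dtac.
  apply: (not_fin_itv HM (P := fun t => a < t /\ t < b) ab) => //.
  exists (map g s) => t [at_ tb].
  have [h1 [h2 h3]] := Hg (f t) (ex_intro _ t (conj at_ (conj tb erefl))).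
  by rewrite -(inj _ _ h1 h2 at_ tb h3); apply: map_f; apply: Hs; exists t.
have [|c [q [cq H]]] := itv_of_not_fin HM (S := S) _ nfin; first by rewrite /def1; dtac.
have [r cr rq] := lt_dense HM cq.
have [s rs sq] := lt_dense HM rq.
have refl x z : a < x -> x < b -> a < z -> z < b -> lto e (f x) (f z) -> x < z.
  move=> ax xb az zb; case: (ltgtP x z) => // [zx|->]; last by rewrite lto_irr.
  by move/lto_nsym; case; apply: mono.
(* the endpoints of the interval are the preimages of [r] and [s], ordered by [e] *)
have [r' [s' [re se rse]]] : exists r' s', [/\ c < r' < q, c < s' < q & lto e r' s'].
  have cs := lt_trans cr rs.
  by case: (e); [exists r, s|exists s, r]; split; rewrite /lto ?cr ?rq ?cs ?sq.
case/andP: re => cr' r'q; case/andP: se => cs' s'q.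
have [x [ax [xb fx]]] := H r' cr' r'q; have [z [az [zb fz]]] := H s' cs' s'q.
have xz : x < z by apply: refl => //; rewrite fx fz.
exists x, z; split=> //.
  by move=> t xt tz; rewrite (lt_trans ax xt) (lt_trans tz zb).
move=> t xt tz.
have at_ := lt_trans ax xt; have tb := lt_trans tz zb.
have f1 : lto e r' (f t) by rewrite -fx; apply: mono.
have f2 : lto e (f t) s' by rewrite -fz; apply: mono.
have ct : c < f t /\ f t < q.
  by case: (e) f1 f2 => /= f1 f2; split;
    (apply: lt_trans f1 || apply: lt_trans f2 _ || apply: lt_trans f2 || apply: lt_trans f1 _).
move=> p p' pf fp'.
(* [y1] and [y2] are attained values on either side of [f t], within the prescribed bounds; their
   preimages delimit the neighbourhood. *)
have [|y1 + y1t] := lt_dense HM (x := Order.max p c) (y := f t).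
  by rewrite gt_max pf (proj1 ct).
rewrite gt_max => /andP[py1 cy1].
have [|y2 ty2] := lt_dense HM (x := f t) (y := Order.min p' q).
  by rewrite lt_min fp' (proj2 ct).
rewrite lt_min => /andP[y2p y2q].
have [w1 [aw1 [w1b fw1]]] := H y1 cy1 (lt_trans y1t (proj2 ct)).
have [w2 [aw2 [w2b fw2]]] := H y2 (lt_trans (proj1 ct) ty2) y2q.
have [v1 [v2 [av1 v2b v1t tv2 Hv]]] : exists v1 v2, [/\ a < v1, v2 < b, v1 < t, t < v2 &
    forall y, v1 < y -> y < v2 -> y1 < f y /\ f y < y2].
  case: (e) mono refl => mono refl.
    exists w1, w2; split=> //; try by apply: refl; rewrite ?fw1 ?fw2.
    move=> y h1 h2; rewrite -fw1 -fw2; split; apply: mono => //.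
      exact: lt_trans w2b.
    exact: lt_trans h1.
  exists w2, w1; split=> //; try by apply: refl; rewrite ?fw1 ?fw2.
  move=> y h1 h2; rewrite -fw1 -fw2; split; apply: (mono _ _) => //.
    exact: lt_trans h1.
  exact: lt_trans w1b.
exists v1, v2; split=> //; split=> // y h1 h2; have [g1 g2] := Hv y h1 h2.
by split; [apply: lt_trans g1|apply: lt_trans y2p].
Qed.

(** Monotonicity without mention of its direction: bounds satisfied at two points hold at all points
    between them. In this form it passes from two horizontal slices to a whole box. *)
Definition between l u := forall s t r p q, l < s -> s < t -> t < r -> r < u ->
  p < f s -> f s < q -> p < f r -> f r < q -> p < f t /\ f t < q.

Theorem monotonicity a b : a < b -> exists l u,
  [/\ l < u, on l u (fun t => a < t < b), between l u & on l u cont1].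
Proof.
move=> ab; have [l [u [lu sub [[c Hc]|inj]]]] := const_or_inj ab.
  have e x y : l < x < u -> l < y < u -> f x = f y.
    by move=> /andP[h1 h2] /andP[h3 h4]; rewrite !Hc.
  exists l, u; split=> //.
    move=> s t r p q ls st tr ru; rewrite (e t s) //.
      by rewrite (lt_trans ls st) (lt_trans tr ru).
    by rewrite ls (lt_trans st) ?(lt_trans tr ru).
  move=> t lt tu p q pt tq; exists l, u; split=> //; split=> // y ly yu.
  by rewrite (e y t) ?ly ?lt.
have [e [l1 [u1 [lu1 sub1 mono]]]] := inj_monotone lu inj.
have [l2 [u2 [lu2 sub2 cont]]] := monotone_cont lu1 mono.
exists l2, u2; split=> //.
  move=> t lt tu; have /andP[h1 h2] := sub2 t lt tu.
  by have /andP[h3 h4] := sub1 t h1 h2; apply: sub.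
move=> s t r p q ls st tr ru.
have /andP[ls1 _] := sub2 s ls (lt_trans (lt_trans st tr) ru).
have /andP[_ ru1] := sub2 r (lt_trans ls (lt_trans st tr)) ru.
have := mono s t ls1 st (lt_trans tr ru1).
have := mono t r (lt_trans ls1 st) tr ru1.
case: (e) => /= h1 h2 h3 h4 h5 h6; split;
  by [exact: lt_trans h2|exact: lt_trans h1|exact: lt_trans h1 _|exact: lt_trans h2 _].
Qed.

End Monotonicity.

(** * Generic continuity *)

Section Neighbourhoods.
Variables (d : Order.disp_t) (M : orderType d) (HM : DLO_no_endpoints M).
Local Notation pt := (pt M).

Definition near n (x : pt n) (P : pt n -> Prop) : Prop :=
  exists a b, box a b x /\ forall y, box a b y -> P y.

Lemma near_mono n (x : pt n) (P Q : pt n -> Prop) :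
  (forall y, P y -> Q y) -> near x P -> near x Q.
Proof. by move=> PQ [a [b [abx H]]]; exists a, b; split=> // y /H/PQ. Qed.

Lemma near_self n (x : pt n) P : near x P -> P x.
Proof. by move=> [a [b [abx H]]]; apply: H. Qed.

Lemma near_near n (x : pt n) P : near x P -> near x (fun y => near y P).
Proof. by move=> [a [b [abx H]]]; exists a, b; split=> // y aby; exists a, b. Qed.

Lemma near_and n (x : pt n) P Q : near x P -> near x Q -> near x (fun y => P y /\ Q y).
Proof.
move=> [a [b [abx H]]] [a' [b' [abx' H']]].
have E y : box (fun i => Order.max (a i) (a' i)) (fun i => Order.min (b i) (b' i)) y <->
    box a b y /\ box a' b' y.
  rewrite /box /=; split=> [h|[h h'] i]; last first.
    by rewrite gt_max lt_min; have [-> ->] := h i; have [-> ->] := h' i.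
  by split=> i; have [] := h i; rewrite gt_max lt_min => /andP[? ?] /andP[? ?].
exists (fun i => Order.max (a i) (a' i)), (fun i => Order.min (b i) (b' i)).
by split=> [|y]; rewrite E // => -[/H ? /H' ?].
Qed.

Lemma near_all n (x : pt n) (P : pt n -> Prop) : (forall y, P y) -> near x P.
Proof.
move=> H; have [a Ha] := choice (fun i => lto_succ HM false (x i)).
have [b Hb] := choice (fun i => lto_succ HM true (x i)).
by exists a, b; split=> // i; split; [apply: Ha|apply: Hb].
Qed.

Lemma box_last n (a b z : pt n.+1) : box a b z <->
  box (init a) (init b) (init z) /\ lastc a < lastc z /\ lastc z < lastc b.
Proof.
rewrite /box /=; split=> [h|[h1 h2] i]; first by split=> [i|]; apply: h.
by rewrite -(app_init a) -(app_init b) -(app_init z) /app_last;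
  case: (unlift _ _) => [j|]; [apply: h1|apply: h2].
Qed.

Lemma near_app n (x : pt n) t (P : pt n.+1 -> Prop) : near (app_last x t) P <->
  exists l u, l < t /\ t < u /\ near x (fun y => forall s, l < s -> s < u -> P (app_last y s)).
Proof.
split.
  move=> [a [b [/box_last]]]; rewrite init_app lastc_app => -[h1 [h2 h3]] H.
  exists (lastc a), (lastc b); split=> //; split=> //.
  exists (init a), (init b); split=> // y aby s ls su; apply: H.
  by apply/box_last; rewrite init_app lastc_app.
move=> [l [u [lt [tu [a [b [abx H]]]]]]].
exists (app_last a l), (app_last b u); split.
  by apply/box_last; rewrite !init_app !lastc_app.
move=> y /box_last; rewrite !init_app !lastc_app => -[h1 [h2 h3]].
by rewrite -(app_init y); apply: H.
Qed.

Definition cont_at n (f : pt n -> M) (x : pt n) : Prop :=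
  forall p q, p < f x -> f x < q -> near x (fun y => p < f y /\ f y < q).

Lemma cont_lt n (f : pt n -> M) x q : cont_at f x -> f x < q -> near x (fun y => f y < q).
Proof.
move=> cf fq; have [p pf] := lto_succ HM false (f x).
by apply: near_mono (cf p q pf fq) => y [].
Qed.

Lemma cont_gt n (f : pt n -> M) x p : cont_at f x -> p < f x -> near x (fun y => p < f y).
Proof.
move=> cf fq; have [q pf] := lto_succ HM true (f x).
by apply: near_mono (cf p q fq pf) => y [].
Qed.

(** The interior of [P] is dense. *)
Definition generic n (P : pt n -> Prop) : Prop :=
  forall x Q, near x Q -> exists y, near y (fun z => P z /\ Q z).

Lemma generic_and n (P Q : pt n -> Prop) :
  generic P -> generic Q -> generic (fun x => P x /\ Q x).
Proof.
move=> gP gQ x R /gP[y /gQ[z H]]; exists z.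
by apply: near_mono H => w; tauto.
Qed.

Lemma generic_mono n (P Q : pt n -> Prop) :
  (forall x, P x -> Q x) -> generic P -> generic Q.
Proof.
move=> PQ gP x R /gP[y H]; exists y.
by apply: near_mono H => w [/PQ].
Qed.

Lemma generic_all_ord n m (P : 'I_m -> pt n -> Prop) :
  (forall i, generic (P i)) -> generic (fun x => forall i, P i x).
Proof.
move=> gP; suff: generic (fun x => forall i, i \in enum 'I_m -> P i x).
  by apply: generic_mono => x H i; apply: H; rewrite mem_enum.
elim: (enum 'I_m) => [|i s IH].
  by move=> x R nR; exists x; apply: near_mono nR.
apply: generic_mono (generic_and (gP i) IH) => x [Pi Ps] j.
by rewrite in_cons => /orP[/eqP->|/Ps].
Qed.

End Neighbourhoods.

(** * Density of the continuity points, by induction on the dimension *)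

Section GenericContinuity.
Variables (d : Order.disp_t) (M : orderType d) (HM : DLO_no_endpoints M).
Variables (S : ominimal_structure M) (HS : definable_choice S) (m0 : M).
Local Notation pt := (pt M).

Definition continuity_dense n := forall f : pt n -> M, deff S f -> generic (cont_at f).
Definition definable_split n := forall X : pt n -> Prop, dset S X ->
  forall x P, near x P -> exists y,
    near y (fun z => X z /\ P z) \/ near y (fun z => ~ X z /\ P z).

Definition ind n (X : pt n -> Prop) (c c' : M) x := if `[< X x >] then c else c'.

Lemma deff_ind n (X : pt n -> Prop) c c' : dset S X -> deff S (ind X c c').
Proof. by move=> dX; apply: deff_if => //; apply: deff_cst. Qed.

(** The indicator function of [X] is locally constant wherever it is continuous. *)
Lemma continuity_split n : continuity_dense n -> definable_split n.
Proof.
move=> C X dX x P nP; have [c m0c] := lto_succ HM true m0.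
have [y H] := C _ (deff_ind c m0 dX) x P nP; exists y.
have [cy Py] := near_self H; have {}H : near y P by apply: near_mono H => z [].
have [Xy|Xy] := pselect (X y); [left|right]; apply: near_and H.
  have : m0 < ind X c m0 y by rewrite /ind asboolT.
  by move/(cont_gt HM cy); apply: near_mono => z; rewrite /ind; case: asboolP; rewrite ?ltxx.
have : ind X c m0 y < c by rewrite /ind asboolF.
by move/(cont_lt HM cy); apply: near_mono => z; rewrite /ind; case: asboolP; rewrite ?ltxx.
Qed.

Lemma split_generic n (X : pt n -> Prop) : definable_split n -> dset S X ->
  (forall x, ~ near x (fun y => ~ X y)) -> generic X.
Proof.
move=> G dX H x P /(G X dX)[y [h|h]]; first by exists y.
by case: (H y); apply: near_mono h => z [].
Qed.

(** The endpoints [l] and [u] are chosen definably. At a common continuity point, two values [t < s]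
    strictly between the chosen endpoints remain between them at all nearby points. *)
Lemma uniform_interval n (P : pt n -> M -> M -> Prop) (Q : pt n -> Prop) x :
  continuity_dense n ->
  dset S (fun z : pt n.+2 => P (init (init z)) (lastc (init z)) (lastc z)) ->
  near x (fun y => Q y /\ exists l u, l < u /\ P y l u) ->
  exists y t s, t < s /\ near y (fun z => Q z /\ exists l u, l < t /\ s < u /\ P z l u).
Proof.
move=> C dP H.
have [|f [g [df dg Hfg]]] := choice2 HS m0 (P := fun y l u => l < u /\ P y l u).
  by apply: dset_and dP; dtac.
have [y Hy] := generic_and (C f df) (C g dg) H.
have [[cf cg] [_ /Hfg[fg _]]] := near_self Hy.
have [t ft tg] := lt_dense HM fg; have [s ts sg] := lt_dense HM tg.
exists y, t, s; split=> //.
apply: near_mono (near_and Hy (near_and (cont_lt HM cf ft) (cont_gt HM cg sg))).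
move=> z [[_ [Qz /Hfg[_ Pz]]] [h1 h2]]; split=> //.
by exists (f z), (g z).
Qed.

(** By the germ dichotomy each fibre of [X] or of its complement contains an interval inside
    [(l0, u0)]. Splitting the base makes one case hold over an open set, and [uniform_interval] then
    produces a box. *)
Lemma split_succ n : continuity_dense n -> definable_split n.+1.
Proof.
move=> C X dX z P; rewrite -(app_init z) near_app => -[l0 [u0 [l0t [tu0 H]]]].
have [|y Hy] := continuity_split C (X := fun x => exists l u, l < u /\
    forall t, l < t -> t < u -> l0 < t /\ t < u0 /\ X (app_last x t)) _ H.
  by dtac.
have aux (Y : pt n.+1 -> Prop) : dset S Y ->
   near y (fun x => (forall s, l0 < s -> s < u0 -> P (app_last x s)) /\
     exists l u, l < u /\ forall t, l < t -> t < u -> l0 < t /\ t < u0 /\ Y (app_last x t)) ->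
   exists w, near w (fun z => Y z /\ P z).
  move=> dY /(uniform_interval (P := fun x l u => forall t, l < t -> t < u ->
     l0 < t /\ t < u0 /\ Y (app_last x t)) C).
  case=> [|y1 [t [s [ts Hy1]]]]; first by dtac.
  have [r tr rs] := lt_dense HM ts.
  exists (app_last y1 r); apply/near_app; exists t, s; split=> //; split=> //.
  apply: near_mono Hy1 => x [Px [l [u [lt [su Hlu]]]]] k tk ks.
  have [h1 [h2 h3]] := Hlu k (lt_trans lt tk) (lt_trans ks su).
  by split=> //; apply: Px.
case: Hy => Hy.
  have [|w Hw] := aux X dX; first by apply: near_mono Hy => x [].
  by exists w; left.
have [||w Hw] := aux (fun z => ~ X z); first by dtac.
  apply: near_mono Hy => x [no Px]; split=> //.
  have l0u0 := lt_trans l0t tu0.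
  have [|[v lv Hv]|[v lv Hv]] := @germ_dich _ _ HM S (fun t => X (app_last x t)) true l0.
  - by rewrite /def1; dtac.
  - case: no; exists l0, (Order.min v u0); split; first by rewrite lt_min (lv : l0 < v).
    by move=> t lt; rewrite lt_min => /andP[tv tu]; split=> //; split=> //; apply: Hv.
  exists l0, (Order.min v u0); split; first by rewrite lt_min (lv : l0 < v).
  by move=> t lt; rewrite lt_min => /andP[tv tu]; split=> //; split=> //; apply: Hv.
by exists w; right.
Qed.

Lemma dset_cont_last n (f : pt n.+1 -> M) : deff S f ->
  dset S (fun z : pt n.+1 => cont_at (fun x => f (app_last x (lastc z))) (init z)).
Proof. by move=> df; cbv beta delta [cont_at near box mkset]; dtac. Qed.

(** After shrinking to a box, [f] is monotone and continuous in the last variable, and continuous in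
    the first [n] variables at every point. Bounds on two nearby slices then extend to the region
    between them by [between]. *)
Lemma continuity_succ n : continuity_dense n -> continuity_dense n.+1.
Proof.
move=> C f df z P; rewrite -(app_init z) near_app => -[l0 [u0 [l0t [tu0 H]]]].
have l0u0 := lt_trans l0t tu0.
pose mon x l u := between (fun t => f (app_last x t)) l u /\
  forall t, l < t -> t < u -> l0 < t /\ t < u0 /\ cont1 (fun t => f (app_last x t)) t.
have [||x1 [t1 [t2 [t12 H1]]]] := uniform_interval (P := mon)
    (Q := fun x => forall s, l0 < s -> s < u0 -> P (app_last x s)) (x := init z) C.
- by rewrite /mon /between /cont1; dtac.
- apply: near_mono H => x Px; split=> //.
  have [|l [u [lu sub bt ct]]] := @monotonicity _ _ HM S HS m0 (fun t => f (app_last x t)) _ _ _ l0u0.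
    by rewrite /fun1; dtac.
  exists l, u; split=> //; split=> // t lt tu.
  by have /andP[h1 h2] := sub t lt tu; have := ct t lt tu.
have {H1} : near x1 (fun x => forall t, t1 < t -> t < t2 -> P (app_last x t) /\
     (between (fun t => f (app_last x t)) t1 t2 /\ cont1 (fun t => f (app_last x t)) t)).
  apply: near_mono H1 => x [Px [l [u [lt1 [t2u [bt ct]]]]]] t h1 h2.
  have [k1 [k2 k3]] := ct t (lt_trans lt1 h1) (lt_trans h2 t2u).
  split; first exact: Px.
  split=> // s r w p q ? ? ? ?; apply: bt => //; first exact: lt_trans lt1 _.
  exact: lt_trans t2u.
move=> H1; have [r t1r rt2] := lt_dense HM t12.
have H2 : near (app_last x1 r) (fun z => t1 < lastc z /\ lastc z < t2 /\ P z /\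
     (between (fun t => f (app_last (init z) t)) t1 t2 /\
      cont1 (fun t => f (app_last (init z) t)) (lastc z))).
  apply/near_app; exists t1, t2; split=> //; split=> //.
  by apply: near_mono H1 => x Hx s h1 h2; rewrite init_app lastc_app; split=> //; split=> //; apply: Hx.
(* The alternative of discontinuity in the first [n] variables throughout a box is excluded by
   generic continuity of the single slice at height [lastc w]. *)
have [w [Hw|Hw]] := split_succ C (dset_cont_last df) H2; last first.
  exfalso; move: Hw; rewrite -(app_init w) near_app => -[l [u [lw [wu Hw]]]].
  have dfw : deff S (fun x => f (app_last x (lastc w))) by dtac.
  have [y Hy] := C _ dfw _ _ Hw.
  have [cy nc] := near_self Hy; have [] := nc (lastc w) lw wu.
  by rewrite init_app lastc_app.
exists w; apply: near_mono (near_near Hw) => v Hv; split; last by have [_ [_ [_ []]]] := near_self Hv.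
have [cv [t1v [vt2 [_ [_ c1v]]]]] := near_self Hv.
move: Hv; rewrite -{1}(app_init v) near_app => -[l [u [lv [vu Hv]]]] p q pv vq.
rewrite -(app_init v) in pv vq *.
have [l' [u' [l'v [vu' Hc]]]] := c1v p q pv vq.
(* The heights [s1 < lastc v < s2] are close enough for [f] to satisfy the bounds [p], [q] there, by
   continuity in the last variable. *)
have [|s1 + s1v] := lt_dense HM (x := Order.max l l') (y := lastc v); first by rewrite gt_max lv.
rewrite gt_max => /andP[ls1 l's1].
have [|s2 vs2] := lt_dense HM (x := lastc v) (y := Order.min u u'); first by rewrite lt_min vu.
rewrite lt_min => /andP[s2u s2u'].
have s12 := lt_trans s1v vs2.
have Hvv := near_self Hv.
have [cs1 _] := Hvv s1 ls1 (lt_trans s12 s2u).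
have [cs2 _] := Hvv s2 (lt_trans ls1 s12) s2u.
rewrite init_app lastc_app in cs1; rewrite init_app lastc_app in cs2.
have [ps1 s1q] := Hc s1 l's1 (lt_trans s12 s2u').
have [ps2 s2q] := Hc s2 (lt_trans l's1 s12) s2u'.
apply/near_app; exists s1, s2; split=> //; split=> //.
apply: near_mono (near_and Hv (near_and (cs1 p q ps1 s1q) (cs2 p q ps2 s2q))).
move=> x [Hx [[h1 h2] [h3 h4]]] s s1s ss2.
have [_ [k1 [_ [_ [bt _]]]]] := Hx s1 ls1 (lt_trans s12 s2u).
have [_ [_ [k2 _]]] := Hx s2 (lt_trans ls1 s12) s2u.
rewrite init_app lastc_app in k1 bt; rewrite lastc_app in k2.
exact: bt h1 h2 h3 h4.
Qed.

Theorem generic_continuity n : continuity_dense n.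
Proof.
elim: n => [|n]; last exact: continuity_succ.
move=> f _ x P nP; exists x; apply: near_mono nP => y Py; split=> // p q py yq.
by apply: near_all => // z; rewrite (pt0_eq z y).
Qed.

Lemma generic_of_not_near n (X : pt n -> Prop) : dset S X ->
  (forall x, ~ near x (fun y => ~ X y)) -> generic X.
Proof. exact: split_generic (continuity_split (@generic_continuity n)). Qed.

End GenericContinuity.

(** * Cells and branches *)

Section FiniteUnions.

Inductive funion T (P : set T -> Prop) : set T -> Prop :=
| funion0 : funion P set0
| funionU X V : funion P X -> P V -> funion P (X `|` V).

Lemma funion1 T (P : set T -> Prop) V : P V -> funion P V.
Proof. by move=> PV; rewrite -[V]set0U; apply: funionU => //; apply: funion0. Qed.

Lemma funion_setU T (P : set T -> Prop) X Y : funion P X -> funion P Y -> funion P (X `|` Y).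
Proof.
move=> fX; elim=> [|Z V _ IH PV]; first by rewrite setU0.
by rewrite setUA; apply: funionU.
Qed.

(** A decomposition of the base is pulled back along [f] piece by piece, inside [D]. *)
Lemma funion_preimage T T' (P : set T -> Prop) (Q : set T' -> Prop) (f : T' -> T) D X :
  funion P X -> (forall V, P V -> V `<=` X -> funion Q (D `&` f @^-1` V)) ->
  funion Q (D `&` f @^-1` X).
Proof.
elim=> [|Y V _ IH PV] H; first by rewrite preimage_set0 setI0; apply: funion0.
rewrite preimage_setU setIUr; apply: funion_setU.
  by apply: IH => W PW WY; apply: H => // x /WY; left.
by apply: H => // x; right.
Qed.

End FiniteUnions.

(** * Open cells and their definable connectedness *)

Section Cells.
Variables (d : Order.disp_t) (M : orderType d) (HM : DLO_no_endpoints M).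
Variables (S : ominimal_structure M) (m0 : M).
Local Notation pt := (pt M).

Definition band n (C : set (pt n)) (lo hi : option (pt n -> M)) : set (pt n.+1) :=
  [set x | C (init x) /\
           (if lo is Some f then is_true (f (init x) < lastc x) else True) /\
           (if hi is Some g then is_true (lastc x < g (init x)) else True)].

(** Continuity is required in the ambient space; on an open cell it amounts to continuity relative
    to the cell. *)
Definition bound n (C : set (pt n)) (o : option (pt n -> M)) : Prop :=
  if o is Some f then deff S f /\ forall x, C x -> cont_at f x else True.

(* Open cells whose bounding functions are total. *)
Inductive ocell : forall n, set (pt n) -> Prop :=
| ocell0 : ocell [set: pt 0]
| ocell_band n (C : set (pt n)) lo hi : ocell C -> bound C lo -> bound C hi ->
    (forall x, C x -> match lo, hi with
                      | Some f, Some g => is_true (f x < g x) | _, _ => True end) ->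
    ocell (band C lo hi).

Lemma dset_band n (C : set (pt n)) lo hi :
  dset S C -> bound C lo -> bound C hi -> dset S (band C lo hi).
Proof.
move=> dC; rewrite /band.
by case: lo hi => [f|] [g|] /= => [[df _] [dg _]|[df _] _|_ [dg _]|_ _]; cbv beta delta [mkset]; dtac.
Qed.

Lemma ocell_dset n (C : set (pt n)) : ocell C -> dset S C.
Proof. by elim=> [|k D lo hi _ IH blo bhi _]; [apply: dset_cst|apply: dset_band]. Qed.

Lemma ocell_open n (C : set (pt n)) : ocell C -> forall x, C x -> near x C.
Proof.
elim=> [x _|k D lo hi _ IH blo bhi _ z [Dz [loz hiz]]]; first exact: near_all.
rewrite -(app_init z); apply/near_app.
have [l lz Hl] : exists2 l, l < lastc z & near (init z) (fun y =>
    if lo is Some f then is_true (f y < l) else True).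
  case: lo blo loz => [f [_ cf] fz|_ _]; last first.
    by have [l] := lto_succ HM false (lastc z); exists l => //; apply: near_all.
  have [l fl lz] := lt_dense HM fz; exists l => //.
  by apply: cont_lt fl => //; apply: cf.
have [u zu Hu] : exists2 u, lastc z < u & near (init z) (fun y =>
    if hi is Some f then is_true (u < f y) else True).
  case: hi bhi hiz => [f [_ cf] fz|_ _]; last first.
    by have [u] := lto_succ HM true (lastc z); exists u => //; apply: near_all.
  have [u zu uf] := lt_dense HM fz; exists u => //.
  by apply: cont_gt uf => //; apply: cf.
exists l, u; split=> //; split=> //.
apply: near_mono (near_and (IH _ Dz) (near_and Hl Hu)) => y [Dy [hl hu]] s ls su.
rewrite /band /mkset init_app lastc_app; split=> //; split.
  by case: (lo) hl => // f fl; apply: lt_trans ls.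
by case: (hi) hu => // f fl; apply: lt_trans fl.
Qed.

Lemma ocell_open_cell n (C : set (pt n)) : ocell C -> open_cell S C.
Proof.
elim=> [|k D lo hi oD [s [cD cs]] blo bhi lohi].
  by exists [::]; split=> //; apply: cell_pt.
have dcf f : deff S f /\ (forall x, D x -> cont_at f x) -> def_cont_fun S D f.
  move=> [df cf]; have dD := ocell_dset oD; split.
    by apply: dset_and; [dtac|apply: df].
  move=> x Dx p q px xq; have [lo' [hi' [bx H]]] := cf x Dx p q px xq.
  by exists lo', hi'; split=> // y _; apply: H.
exists (rcons s true); split; last by rewrite -cats1 count_cat cs /= addn1.
apply: cell_band => //.
  by case: lo blo {lohi} => // f /dcf.
by case: hi bhi {lohi} => // f /dcf.
Qed.

(** A definable property that is locally constant on a convex set is constant: a change of value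
    from [s] to [t] is located by a supremum, where local constancy fails. The case [t < s] follows
    by passing to the complement. *)
Lemma itv_connected (P F : M -> Prop) : def1 S P ->
  (forall s t r, F s -> F r -> s < t -> t < r -> F t) ->
  (forall t, F t -> exists l u, l < t /\ t < u /\
     forall s, l < s -> s < u -> F s -> (P s <-> P t)) ->
  forall s t, F s -> F t -> P s -> P t.
Proof.
move=> dP cF.
have key (Q : M -> Prop) : def1 S Q -> (forall t, F t -> exists l u, l < t /\ t < u /\
     forall s, l < s -> s < u -> F s -> (Q s <-> Q t)) ->
    forall s t, F s -> F t -> s < t -> Q s -> Q t.
  move=> dQ loc s t Fs Ft st Qs; apply: contrapT => nQt.
  pose E r := s <= r /\ r < t /\ Q r.
  have [| |r [_ [rt _]]|k [k1 k2]] := @def1_sup _ _ HM S true E t.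
  - by rewrite /def1 /E; dtac.
  - by exists s.
  - exact: (@lto_nsym _ _ true).
  have sk : s <= k by rewrite leNgt; apply/negP; apply: k1.
  have kt : k <= t.
    rewrite leNgt; apply/negP => tk; have [r [_ [rt _]] tr] := k2 t tk.
    by move: (lt_trans rt tr); rewrite ltxx.
  have Fk : F k.
    move: sk kt; rewrite !le_eqVlt => /orP[/eqP<- //|sk] /orP[/eqP->//|kt].
    exact: cF sk kt.
  have [l [u [lk [ku H]]]] := loc k Fk.
  have [Qk|nQk] := pselect (Q k).
    have kt' : k < t by rewrite lt_neqAle kt andbT; apply/eqP => e; apply: nQt; rewrite -e.
    have [|r kr] := lt_dense HM (x := k) (y := Order.min u t); first by rewrite lt_min ku.
    rewrite lt_min => /andP[ru rt].
    suff Er : E r by apply: (k1 r Er).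
    split; first exact: le_trans (ltW kr).
    split=> //; apply/H => //; first exact: lt_trans kr.
    exact: cF Fk Ft kr rt.
  have [r Er lr] := k2 l lk; have := k1 r Er => /negP; rewrite -leNgt => rk.
  case: Er => sr [rt Qr].
  apply: nQk; apply/(H r) => //; first exact: le_lt_trans ku.
  move: sr; rewrite le_eqVlt => /orP[/eqP<- //|sr].
  exact: cF sr rt.
move=> loc s t Fs Ft Ps; case: (ltgtP s t) => [st|ts|<- //].
  exact: (key P) st Ps.
apply: contrapT => nPt.
apply: (key (fun r => ~ P r) _ _ t s Ft Fs ts nPt Ps); first exact: dset_not.
move=> r /loc[l [u [lr [ru H]]]]; exists l, u; split=> //; split=> // k lk ku Fk.
by have := H k lk ku Fk; tauto.
Qed.

(** Definable connectedness, phrased through locally constant definable properties instead of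
    relatively clopen subsets. *)
Definition connected n (C : set (pt n)) : Prop := forall Y : pt n -> Prop, dset S Y ->
  (forall x, C x -> near x (fun y => C y -> (Y y <-> Y x))) ->
  (forall x, C x -> Y x) \/ (forall x, C x -> ~ Y x).

Lemma band_fibre n (C : set (pt n)) (lo hi : option (pt n -> M)) x : C x ->
    match lo, hi with Some f, Some g => is_true (f x < g x) | _, _ => True end ->
  exists t, band C lo hi (app_last x t).
Proof.
rewrite /band /mkset => Cx H.
have E t : (init (app_last x t) = x) * (lastc (app_last x t) = t).
  by rewrite init_app lastc_app.
case: lo hi H => [f|] [g|] H.
- by have [t ft tg] := lt_dense HM H; exists t; rewrite !E.
- by have [t ft] := lto_succ HM true (f x); exists t; rewrite !E.
- by have [t ft] := lto_succ HM false (g x); exists t; rewrite !E.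
- by exists m0; rewrite !E.
Qed.

(** The fibres of a band are convex, so [Y] is constant on each of them and descends to a property
    [Z] of the base, again locally constant. *)
Lemma ocell_connected n (C : set (pt n)) : ocell C -> connected C.
Proof.
elim=> [Y dY _|k D lo hi oD IH blo bhi lohi Y dY loc].
  pose x0 : pt 0 := fun _ => m0.
  by have [Y0|Y0] := pselect (Y x0); [left|right] => x _; rewrite (pt0_eq x x0).
set B := band D lo hi in loc *.
have oB : ocell B by apply: ocell_band.
have dB := ocell_dset oB.
have {}loc z : B z -> near z (fun w => B w /\ (Y w <-> Y z)).
  move=> Bz; apply: near_mono (near_and (ocell_open oB Bz) (loc z Bz)).
  by move=> w [Bw H]; split=> //; apply: H.
have fibre x s t : B (app_last x s) -> B (app_last x t) -> Y (app_last x s) -> Y (app_last x t).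
  apply: (itv_connected (P := fun t => Y (app_last x t)) (F := fun t => B (app_last x t))).
  - by rewrite /def1; dtac.
  - move=> s' t' r'; rewrite /B /band /mkset !init_app !lastc_app => -[Dx [l1 h1]] [_ [l2 h2]] st tr.
    split=> //; split.
      by case: (lo) l1 => // f fs; apply: lt_trans st.
    by case: (hi) h2 => // f fs; apply: lt_trans tr _.
  - move=> t' /loc /near_app [l [u [lt [tu H]]]]; exists l, u; split=> //; split=> // s' ls su _.
    by have [] := near_self H s' ls su.
pose Z x := exists t, B (app_last x t) /\ Y (app_last x t).
have dZ : dset S Z by rewrite /Z; dtac.
have HZ x t : B (app_last x t) -> (Z x <-> Y (app_last x t)).
  move=> Bt; split; last by exists t.
  by move=> [s [Bs Ys]]; apply: fibre Ys.
have [x Dx|H|H] := IH Z dZ.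
- have [t Bt] := band_fibre Dx (lohi x Dx).
  have /near_app[l [u [lt [tu H]]]] := loc _ Bt.
  apply: near_mono H => y Hy _; have [By Yy] := Hy t lt tu.
  by rewrite (HZ y t By) (HZ x t Bt).
- left=> z Bz; have := H (init z) (proj1 Bz).
  by rewrite (HZ _ (lastc z)) app_init.
- right=> z Bz Yz; apply: (H (init z) (proj1 Bz)).
  by exists (lastc z); rewrite app_init.
Qed.

Lemma cont_ind_connected n (C : set (pt n)) (P : pt n -> Prop) c : ocell C -> dset S P ->
  m0 < c -> (forall x, C x -> cont_at (ind P c m0) x) ->
  (forall x, C x -> P x) \/ (forall x, C x -> ~ P x).
Proof.
move=> oC dP m0c cP; apply: ocell_connected => // x Cx.
have [Px|nPx] := pselect (P x).
  have h : m0 < ind P c m0 x by rewrite /ind asboolT.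
  apply: near_mono (cont_gt HM (cP x Cx) h) => y; rewrite /ind.
  by case: asboolP => // _; rewrite ltxx.
have h : ind P c m0 x < c by rewrite /ind asboolF.
apply: near_mono (cont_lt HM (cP x Cx) h) => y; rewrite /ind.
by case: asboolP => // _; rewrite ltxx.
Qed.

End Cells.

(** * Definable sets with finite fibres and continuity along their branches *)

Section Branches.
Variables (d : Order.disp_t) (M : orderType d) (HM : DLO_no_endpoints M).
Variables (S : ominimal_structure M) (HS : definable_choice S) (m0 : M).
Local Notation pt := (pt M).

Lemma fin_sub (P Q : M -> Prop) : (forall t, P t -> Q t) -> fin Q -> fin P.
Proof. by move=> PQ [s Hs]; exists s => t /PQ/Hs. Qed.

Lemma fin_min (P : M -> Prop) : fin P -> (exists t, P t) ->
  exists t, P t /\ forall s, s < t -> ~ P s.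
Proof.
move=> [s]; elim: s P => [|x s IH] P Hs [t Pt]; first by have := Hs t Pt.
have [Px|nPx] := pselect (P x); last first.
  apply: (IH P); last by exists t.
  move=> r Pr; have := Hs r Pr; rewrite in_cons => /orP[/eqP e|//].
  by case: nPx; rewrite -e.
have [[r [Pr rx]]|no] := pselect (exists r, P r /\ r < x); last first.
  by exists x; split=> // r rx Pr; apply: no; exists r.
have [|| k [[Pk kx] Hk]] := IH (fun r => P r /\ r < x).
- by move=> k [Pk kx]; have := Hs k Pk; rewrite in_cons (lt_eqF kx).
- by exists r.
exists k; split=> // j jk Pj; apply: (Hk j jk); split=> //.
exact: lt_trans kx.
Qed.

Lemma germ_not_fin (P : M -> Prop) b x : germ b x P -> ~ fin P.
Proof.
case: b => -[u xu Pu]; apply: (not_fin_itv HM) xu _ => t h1 h2; exact: Pu.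
Qed.

Lemma fin_isolated (P : M -> Prop) y : def1 S P -> fin P ->
  exists l u, l < y /\ y < u /\ forall t, l < t -> t < u -> P t -> t = y.
Proof.
move=> dP fP; have [/germ_not_fin//|[u yu Hu]] := germ_dich HM true y dP.
have [/germ_not_fin//|[l ly Hl]] := germ_dich HM false y dP.
exists l, u; split=> //; split=> // t lt tu Pt.
case: (ltgtP t y) => // h; [case: (Hl t h lt Pt)|case: (Hu t h tu Pt)].
Qed.

(** Continuity at [z] of [h] along [A], that is, tested only on nearby points of [A]. *)
Definition relcont n (A : pt n -> Prop) (h : pt n -> M) z := forall p q, p < h z -> h z < q ->
  near z (fun w => A w -> p < h w /\ h w < q).

Lemma dset_relcont n (A : pt n -> Prop) h : dset S A -> deff S h -> dset S (relcont A h).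
Proof. by move=> dA dh; cbv beta delta [relcont near box mkset]; dtac. Qed.

(** If the claim failed on an open set, a bad branch [b] could be chosen there. At a common
    continuity point of [b], of [h] along [b] and of the isolating bounds, this branch turns out not
    to be bad. *)
Lemma branch_continuity n (A : pt n.+1 -> Prop) (h : pt n.+1 -> M) :
  dset S A -> (forall x, fin (fun t => A (app_last x t))) -> deff S h ->
  generic (fun x => forall y, A (app_last x y) -> relcont A h (app_last x y)).
Proof.
move=> dA fA dh; have dR := dset_relcont dA dh.
apply: (generic_of_not_near HM HS m0) => [|x nx]; first by dtac.
have [|b db Hb] := choice1 HS m0 (P := fun x y => A (app_last x y) /\ ~ relcont A h (app_last x y)).
  by dtac.
have {}Hb y : ~ (forall t, A (app_last y t) -> relcont A h (app_last y t)) ->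
    A (app_last y (b y)) /\ ~ relcont A h (app_last y (b y)).
  move=> no; apply: Hb; apply: contrapT => H; apply: no => t At; apply: contrapT => nr.
  by apply: H; exists t.
have [|l [u [dl du Hlu]]] := choice2 HS m0 (P := fun x l u => l < b x /\ b x < u /\
    forall t, l < t -> t < u -> A (app_last x t) -> t = b x).
  by dtac.
have {}Hlu y : l y < b y /\ b y < u y /\
    forall t, l y < t -> t < u y -> A (app_last y t) -> t = b y.
  by apply: Hlu; apply: fin_isolated; [rewrite /def1; dtac|apply: fA].
have dhb : deff S (fun y => h (app_last y (b y))) by dtac.
have C := generic_continuity HM HS m0 (n := n).
have [y Hy] := generic_and (generic_and (C b db) (C _ dhb)) (generic_and (C l dl) (C u du)) nx.
have [[[cb chb] [cl cu]] /Hb[Ab]] := near_self Hy; apply=> p q pb bq.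
have [lb [bu _]] := Hlu y.
(* The fixed interval [(l0, u0)] isolates [b z] in its fibre for all [z] near [y], so the points of
   [A] near [(y, b y)] are the points [(z, b z)]. *)
have [l0 ll0 l0b] := lt_dense HM lb; have [u0 bu0 u0u] := lt_dense HM bu.
apply/near_app; exists l0, u0; split=> //; split=> //.
apply: near_mono (near_and (chb p q pb bq) (near_and (cont_lt HM cl ll0) (cont_gt HM cu u0u))).
move=> z [hz [lz zu]] s ls su As.
have [_ [_ /(_ s) ->]] := Hlu z => //; first exact: lt_trans ls.
exact: lt_trans zu.
Qed.

Lemma relcont_comp n (A : pt n.+1 -> Prop) h (f : pt n -> M) x :
  relcont A h (app_last x (f x)) -> cont_at f x -> near x (fun y => A (app_last y (f y))) ->
  cont_at (fun y => h (app_last y (f y))) x.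
Proof.
move=> rh cf nA p q px xq; have /near_app[l [u [lf [fu H]]]] := rh p q px xq.
apply: near_mono (near_and H (near_and nA (cf l u lf fu))) => y [Hy [Ay [ly yu]]].
exact: Hy.
Qed.

End Branches.

(** * Decomposition into open cells and thin sets *)

Section Decomposition.
Variables (d : Order.disp_t) (M : orderType d) (HM : DLO_no_endpoints M).
Variables (S : ominimal_structure M) (HS : definable_choice S) (m0 : M).
Local Notation pt := (pt M).

Definition thin n (X : set (pt n)) : Prop :=
  exists i, forall x y, X x -> X y -> (forall j, j != i -> x j = y j) -> x = y.

Definition piece n (X : set (pt n)) : Prop := dset S X /\ (ocell S X \/ thin X).

Lemma thin_graph n (X : set (pt n.+1)) (f : pt n -> M) :
  (forall z, X z -> lastc z = f (init z)) -> thin X.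
Proof.
move=> H; exists ord_max => x y Xx Xy xy.
have exy : init x = init y by apply/funext => j; apply: xy; rewrite eq_sym neq_lift.
by rewrite -(app_init x) -(app_init y) (H x Xx) (H y Xy) exy.
Qed.

Lemma thin_cylinder n (X : set (pt n)) (D : set (pt n.+1)) :
  thin X -> thin (D `&` @init _ M n @^-1` X).
Proof.
move=> [i H]; exists (lift ord_max i) => x y [_ Xx] [_ Xy] xy.
have exy : init x = init y.
  by apply: H => // j ji; apply: xy; rewrite (inj_eq lift_inj).
rewrite -(app_init x) -(app_init y) exy; congr app_last.
by apply: xy; rewrite neq_lift.
Qed.

(** * Decomposition of a set along the boundary of its fibres *)

Section Fibres.
Variables (n : nat) (D : set (pt n.+1)).
Hypothesis dD : dset S D.

Definition fibre_bd (z : pt n.+1) := forall l u, l < lastc z -> lastc z < u ->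
  (exists t, l < t /\ t < u /\ D (app_last (init z) t)) /\
  (exists t, l < t /\ t < u /\ ~ D (app_last (init z) t)).

Lemma dset_fibre_bd : dset S fibre_bd. Proof. by rewrite /fibre_bd; dtac. Qed.

#[local] Hint Resolve dset_fibre_bd : definable.

(** An infinite boundary would contain an interval, while membership in [D] is constant just to the
    right of its left end. *)
Lemma fin_fibre_bd x : fin (fun t => fibre_bd (app_last x t)).
Proof.
have [|//|[l [u [lu H]]]] := @fin_or_itv _ _ HM S (fun t => fibre_bd (app_last x t)).
  by rewrite /def1; dtac.
exfalso; have [|[v lv Hv]|[v lv Hv]] := @germ_dich _ _ HM S (fun t => D (app_last x t)) true l.
- by rewrite /def1; dtac.
- have [|t lt] := lt_dense HM (x := l) (y := Order.min u v); first by rewrite lt_min lu.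
  rewrite lt_min => /andP[tu tv].
  have := H t lt tu l v; rewrite init_app lastc_app => /(_ lt tv) [_ [s [ls [sv nD]]]].
  exact/nD/Hv.
have [|t lt] := lt_dense HM (x := l) (y := Order.min u v); first by rewrite lt_min lu.
rewrite lt_min => /andP[tu tv].
have := H t lt tu l v; rewrite init_app lastc_app => /(_ lt tv) [[s [ls [sv Ds]]] _].
exact: (Hv s).
Qed.

(** Away from the boundary, membership in [D] is locally constant along the fibre. *)
Lemma fibre_constant x (F : M -> Prop) : (forall s t r, F s -> F r -> s < t -> t < r -> F t) ->
  (forall t, F t -> ~ fibre_bd (app_last x t)) ->
  forall s t, F s -> F t -> D (app_last x s) -> D (app_last x t).
Proof.
move=> cF nA; apply: (itv_connected HM (S := S) (P := fun t => D (app_last x t))) => //.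
  by rewrite /def1; dtac.
move=> t Ft; apply: contrapT => no; apply: (nA t Ft) => l u.
rewrite init_app lastc_app => lt tu; apply: contrapT => no2; apply: no.
exists l, u; split=> //; split=> // s ls su Fs.
have [Dt|nDt] := pselect (D (app_last x t)); split=> // h.
  by apply: contrapT => nDs; apply: no2; split; [exists t|exists s].
by exfalso; apply: no2; split; [exists s|exists t].
Qed.

Definition has_next z := exists t, lastc z < t /\ fibre_bd (app_last (init z) t).
Definition is_next z t := lastc z < t /\ fibre_bd (app_last (init z) t) /\
  forall s, lastc z < s -> s < t -> ~ fibre_bd (app_last (init z) s).
Definition goes_up z := germ true (lastc z) (fun t => D (app_last (init z) t)).

Lemma dset_has_next : dset S has_next. Proof. by rewrite /has_next; dtac. Qed.
Lemma dset_goes_up : dset S goes_up. Proof. by rewrite /goes_up /germ; dtac. Qed.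

#[local] Hint Resolve dset_has_next dset_goes_up : definable.

Lemma has_nextP z : has_next z -> exists t, is_next z t.
Proof.
move=> H; have [|t [[zt At] Ht]] := fin_min (P := fun t => lastc z < t /\ fibre_bd (app_last (init z) t)) _ H.
  by apply: fin_sub (fin_fibre_bd (init z)) => t [].
exists t; split=> //; split=> // s zs st As.
exact: (Ht s).
Qed.

(** [next] and [least] have arbitrary values where no next or least branch exists; [c] is a second
    value, beside [m0], for indicator functions. *)
Variables (next : pt n.+1 -> M) (least : pt n -> M) (c : M).
Hypothesis dnext : deff S next.
Hypothesis nextP : forall z, has_next z -> is_next z (next z).
Hypothesis dleast : deff S least.
Hypothesis leastP : forall x, (exists t, fibre_bd (app_last x t)) ->
  fibre_bd (app_last x (least x)) /\ forall s, s < least x -> ~ fibre_bd (app_last x s).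
Hypothesis m0c : m0 < c.

(** Over [x], the least branch, the passage to the next branch, its existence, and the side of [D]
    just above a branch all vary continuously. *)
Definition good x := cont_at least x /\
  forall y, fibre_bd (app_last x y) -> relcont fibre_bd next (app_last x y) /\
    (relcont fibre_bd (ind has_next c m0) (app_last x y) /\
     relcont fibre_bd (ind goes_up c m0) (app_last x y)).

Lemma dset_good : dset S good.
Proof.
rewrite /good; apply: dset_and; first by cbv beta delta [cont_at near box mkset]; dtac.
have d1 := dset_relcont dset_fibre_bd dnext.
have d2 := dset_relcont dset_fibre_bd (deff_ind c m0 dset_has_next).
have d3 := dset_relcont dset_fibre_bd (deff_ind c m0 dset_goes_up).
by dtac.
Qed.

Lemma generic_good : generic good.
Proof.
apply: generic_and; first exact: (generic_continuity HM HS m0).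
have B h := branch_continuity HM HS m0 dset_fibre_bd fin_fibre_bd (h := h).
have := generic_and (B _ dnext)
  (generic_and (B _ (deff_ind c m0 dset_has_next)) (B _ (deff_ind c m0 dset_goes_up))).
by apply: generic_mono => x [h1 [h2 h3]] y Ay; split; [apply: h1|split; [apply: h2|apply: h3]].
Qed.

Section OverCell.
Variable V : set (pt n).
Hypotheses (oV : ocell S V) (Vgood : V `<=` good).

Definition section_of (f : pt n -> M) := deff S f /\
  forall x, V x -> cont_at f x /\ fibre_bd (app_last x (f x)).

Let dV : dset S V := ocell_dset oV.

(** Along a continuous branch the indicator of [P] is continuous, hence constant because [V] is
    definably connected. *)
Lemma section_flag f P : section_of f -> dset S P ->
  (forall x y, good x -> fibre_bd (app_last x y) -> relcont fibre_bd (ind P c m0) (app_last x y)) ->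
  (forall x, V x -> P (app_last x (f x))) \/ (forall x, V x -> ~ P (app_last x (f x))).
Proof.
move=> [df fV] dP H.
apply: (cont_ind_connected HM (P := fun x => P (app_last x (f x))) oV _ m0c); first by dtac.
move=> x Vx; have [cf Af] := fV x Vx.
apply: (relcont_comp (h := ind P c m0)) (H x (f x) (Vgood Vx) Af) cf _.
by apply: near_mono (ocell_open HM oV Vx) => y /fV[].
Qed.

Lemma piece_graph f : section_of f -> funion (@piece n.+1)
  [set z | D z /\ V (init z) /\ lastc z = f (init z)].
Proof.
move=> [df _]; apply: funion1; split; first by cbv beta delta [mkset]; dtac.
by right; apply: (thin_graph (f := f)) => z [_ []].
Qed.

Lemma piece_band (lo hi : option (pt n -> M)) :
  bound S V lo -> bound S V hi ->
  (forall x, V x -> match lo, hi with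
                    | Some f, Some g => is_true (f x < g x) | _, _ => True end) ->
  (forall z, band V lo hi z -> D z) \/ (forall z, band V lo hi z -> ~ D z) ->
  funion (@piece n.+1) (D `&` band V lo hi).
Proof.
move=> blo bhi lohi [H|H].
  rewrite setIidr //; apply: funion1; have oB := ocell_band oV blo bhi lohi.
  by split; [apply: ocell_dset|left].
rewrite (_ : setI D _ = set0); first exact: funion0.
by apply/seteqP; split=> // z [Dz /H].
Qed.

(** Strictly between two consecutive branches each fibre is constant, so membership in [D] is read
    off just above [f]. This is the flag [goes_up], constant along the section. *)
Lemma band_above f (hi : option (pt n -> M)) : section_of f ->
  (forall x t, V x -> f x < t -> (if hi is Some g then is_true (t < g x) else True) ->
     ~ fibre_bd (app_last x t)) ->
  (forall x, V x -> if hi is Some g then is_true (f x < g x) else True) ->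
  (forall z, band V (Some f) hi z -> D z) \/ (forall z, band V (Some f) hi z -> ~ D z).
Proof.
move=> sf nA flt.
have K z : band V (Some f) hi z -> exists s, [/\ f (init z) < s,
    (if hi is Some g then is_true (s < g (init z)) else True),
    D (app_last (init z) s) <-> goes_up (app_last (init z) (f (init z))) &
    D (app_last (init z) s) <-> D z].
  move=> [Vz [fz zh]].
  have gz : germ true (f (init z)) (fun t => if hi is Some g then is_true (t < g (init z)) else True).
    have := flt _ Vz; case: (hi) => [g fg|_]; last exact: germ_all.
    exact: germ_lt.
  have DD s : f (init z) < s -> (if hi is Some g then is_true (s < g (init z)) else True) ->
      (D (app_last (init z) s) <-> D z).
    move=> fs sh; rewrite -[X in _ <-> D X](app_init z).
    have cv := @fibre_constant (init z) (fun t => f (init z) < t /\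
       (if hi is Some g then is_true (t < g (init z)) else True)) _ _.
    split; apply: cv => //.
    - move=> k t r [fk kh] [fr rh] kt tr; split; first exact: lt_trans kt.
      by case: (hi) rh => // g rg; apply: lt_trans rg.
    - by move=> t [ft th]; apply: nA.
    - move=> k t r [fk kh] [fr rh] kt tr; split; first exact: lt_trans kt.
      by case: (hi) rh => // g rg; apply: lt_trans rg.
    - by move=> t [ft th]; apply: nA.
  have [|gD|gD] := @germ_dich _ _ HM S (fun t => D (app_last (init z) t)) true (f (init z)).
  - by rewrite /def1; dtac.
  - have [s fs [Ds sh]] := germ_ex HM (germ_and gD gz).
    by exists s; split=> //; [rewrite /goes_up init_app lastc_app|apply: DD].
  - have [s fs [Ds sh]] := germ_ex HM (germ_and gD gz).
    exists s; split=> //; last exact: DD.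
    rewrite /goes_up init_app lastc_app; split=> // g.
    by have [r _ []] := germ_ex HM (germ_and gD g).
have [||H|H] := section_flag (P := goes_up) sf; first exact: dset_goes_up.
- by move=> x y [_ H] /H[_ []].
- by left=> z Bz; have [s [_ _ h1 h2]] := K z Bz; apply/h2/h1/H; case: Bz.
- by right=> z Bz Dz; have [s [_ _ h1 h2]] := K z Bz; apply: (H (init z)); [case: Bz|apply/h1/h2].
Qed.

Lemma bound_section f : section_of f -> bound S V (Some f).
Proof. by move=> [df fV]; split=> // x /fV[]. Qed.

(* Climbing from a branch of [fibre_bd] to the next one; the number of branches above a fixed
   point [x0] of the connected base decreases. *)
Lemma above x0 f : V x0 -> section_of f ->
  funion (@piece n.+1) [set z | D z /\ V (init z) /\ f (init z) < lastc z].
Proof.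
move=> Vx0; have [r Hr] := fin_fibre_bd x0.
have {Hr} : forall t, f x0 < t -> fibre_bd (app_last x0 t) -> t \in r by move=> t _; apply: Hr.
have [k] := ubnP (size r); elim: k r f => // k IH r f /ltnSE rk Hr sf.
have [||H|H] := section_flag (P := has_next) sf; first exact: dset_has_next.
- by move=> x y [_ H] /H[_ []].
- pose g x := next (app_last x (f x)).
  have Hg x : V x -> [/\ f x < g x, fibre_bd (app_last x (g x)) &
      forall s, f x < s -> s < g x -> ~ fibre_bd (app_last x s)].
    move=> Vx; have := nextP (H x Vx); rewrite /is_next init_app lastc_app => -[h1 [h2 h3]].
    by [].
  have sg : section_of g.
    have [df fV] := sf; split; first by rewrite /g; dtac.
    move=> x Vx; have [cf Af] := fV x Vx; have [_ Ag _] := Hg x Vx; split=> //.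
    apply: (relcont_comp (h := next)) (proj1 (proj2 (Vgood Vx) _ Af)) cf _.
    by apply: near_mono (ocell_open HM oV Vx) => y /fV[].
  have -> : [set z | D z /\ V (init z) /\ f (init z) < lastc z] =
      (D `&` band V (Some f) (Some g)) `|`
      ([set z | D z /\ V (init z) /\ lastc z = g (init z)] `|`
       [set z | D z /\ V (init z) /\ g (init z) < lastc z]).
    apply/seteqP; split=> z /=.
      move=> [Dz [Vz fz]]; case: (ltgtP (lastc z) (g (init z))) => h.
      - by left.
      - by right; right.
      - by right; left.
    move=> [[Dz [Vz [fz _]]]|[[Dz [Vz ->]]|[Dz [Vz gz]]]]; split=> //; split=> //.
      by have [] := Hg _ Vz.
    by have [fg _ _] := Hg _ Vz; apply: lt_trans gz.
  apply: funion_setU.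
    apply: piece_band => //; try exact: bound_section.
      by move=> x /Hg[].
    apply: band_above => //; last by move=> x /Hg[].
    by move=> x t Vx ft tg; have [_ _] := Hg x Vx; apply.
  apply: funion_setU; first exact: piece_graph.
  have [fg Ag _] := Hg x0 Vx0; have gr := Hr _ fg Ag.
  apply: (IH (rem (g x0) r)) => //.
    by rewrite size_rem // prednK //; case: (r) gr.
  move=> t gt At; have := Hr t (lt_trans fg gt) At.
  by apply: rem_mem; rewrite (gt_eqF gt).
- have -> : [set z | D z /\ V (init z) /\ f (init z) < lastc z] = D `&` band V (Some f) None.
    by apply/seteqP; split=> z /= => [[? [? ?]]|[? [? [? _]]]].
  apply: piece_band => //; first exact: bound_section.
  apply: band_above => // x t Vx ft _ At; apply: (H x Vx).
  by exists t; rewrite init_app lastc_app.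
Qed.

End OverCell.

(** A nonempty open cell meets the dense interior of [good]. *)
Lemma empty_type V : ocell S V -> V `<=` (fun x => ~ good x) -> V = set0.
Proof.
move=> oV Vbad; apply/seteqP; split=> // x Vx.
have [y Hy] := generic_good (ocell_open HM oV Vx).
by have [gy /Vbad] := near_self Hy.
Qed.

(* Below the least branch, membership in [D] is recorded by its germ at [-oo]. *)
Definition low_end x := exists l, forall t, t < l -> D (app_last x t).
Definition has_bd x := exists t, fibre_bd (app_last x t).

Lemma over_empty V : ocell S V -> V `<=` (fun x => ~ has_bd x) ->
  (forall x, V x -> low_end x) \/ (forall x, V x -> ~ low_end x) ->
  funion (@piece n.+1) (D `&` @init _ M n @^-1` V).
Proof.
move=> oV VA lowV.
have -> : @init _ M n @^-1` V = band V None None.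
  by apply/seteqP; split=> z /= => [?|[]].
have H z s : V (init z) -> (D (app_last (init z) s) <-> D z).
  move=> Vz; rewrite -[X in _ <-> D X](app_init z).
  (* Without boundary points the convex set can be the whole line: each fibre is full or empty. *)
  have cv := @fibre_constant (init z) (fun _ => True) (fun _ _ _ _ _ _ _ => I) _.
  by split; apply: cv => // t _ At; apply: (VA _ Vz); exists t.
apply: piece_band => //; case: lowV => lowV; [left|right] => z [Vz _].
  have [l Hl] := lowV _ Vz; have [t tl] := lto_succ HM false l.
  by apply/(H z t Vz)/Hl.
move=> Dz; apply: (lowV _ Vz); exists m0 => t _.
exact/(H z t Vz).
Qed.

(** The cylinder is cut along the least branch: the band below it is settled by [low_end], the graph
    is thin, and the part above is climbed branch by branch. *)
Lemma over_nonempty V : ocell S V -> V `<=` good -> V `<=` has_bd ->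
  (forall x, V x -> low_end x) \/ (forall x, V x -> ~ low_end x) ->
  funion (@piece n.+1) (D `&` @init _ M n @^-1` V).
Proof.
move=> oV Vgood VA lowV.
have [[x0 Vx0]|no] := pselect (exists x, V x); last first.
  rewrite (_ : setI D _ = set0); first exact: funion0.
  by apply/seteqP; split=> // z [_ Vz]; apply: no; exists (init z).
have sl : deff S least /\ forall x, V x -> cont_at least x /\ fibre_bd (app_last x (least x)).
  by split=> // x Vx; split; [have [] := Vgood x Vx|have [] := leastP (VA x Vx)].
have -> : D `&` @init _ M n @^-1` V = (D `&` band V None (Some least)) `|`
      ([set z | D z /\ V (init z) /\ lastc z = least (init z)] `|`
       [set z | D z /\ V (init z) /\ least (init z) < lastc z]).
  apply/seteqP; split=> z /=.
    move=> [Dz Vz]; case: (ltgtP (lastc z) (least (init z))) => h.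
    - by left.
    - by right; right.
    - by right; left.
  by move=> [[Dz []]|[[Dz []]|[Dz []]]].
apply: funion_setU; last first.
  by apply: funion_setU; [exact: piece_graph sl|exact: above Vx0 sl].
apply: piece_band => //; first by split=> // x /Vgood[].
have H z s : band V None (Some least) z -> s < least (init z) ->
    (D (app_last (init z) s) <-> D z).
  move=> [Vz [_ zl]] sl'; rewrite -[X in _ <-> D X](app_init z).
  have cv := @fibre_constant (init z) (fun t => t < least (init z))
    (fun _ t r _ rl _ tr => lt_trans tr rl) _.
  by split; apply: cv => // t tl; apply: (proj2 (leastP (VA _ Vz))).
case: lowV => lowV; [left|right] => z Bz.
  have [l Hl] := lowV _ (proj1 Bz).
  have [t] := lto_succ HM false (Order.min l (least (init z))).
  rewrite /lto lt_min => /andP[tl tm].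
  by apply/(H z t Bz tm)/Hl.
move=> Dz; apply: (lowV _ (proj1 Bz)); exists (least (init z)) => t tl.
exact/(H z t Bz tl).
Qed.

(** The base is partitioned according to [good], [has_bd] and [low_end], and each part is decomposed
    inductively. Thin base pieces have thin cylinders; open base cells fall under the preceding
    cases. *)
Lemma fibres_decomposition : (forall X : set (pt n), dset S X -> funion (@piece n) X) ->
  funion (@piece n.+1) D.
Proof.
move=> IH.
have dlow : dset S low_end by rewrite /low_end; dtac.
have dne : dset S has_bd by rewrite /has_bd; dtac.
have part (X : set (pt n)) : dset S X ->
    (forall V, ocell S V -> V `<=` X -> funion (@piece n.+1) (D `&` @init _ M n @^-1` V)) ->
    funion (@piece n.+1) (D `&` @init _ M n @^-1` X).
  move=> dX H; apply: funion_preimage (IH X dX) _ => V [dV [oV|tV]] VX; first exact: H.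
  apply: funion1; split; last by right; apply: thin_cylinder.
  by cbv beta delta [setI preimage mkset]; dtac.
pose T b1 b2 : set (pt n) := [set x | good x /\
   ((if b1 then has_bd x else ~ has_bd x) /\ (if b2 then low_end x else ~ low_end x))].
have dT b1 b2 : dset S (T b1 b2).
  by have dg := dset_good; case: b1; case: b2; cbv beta iota delta [T mkset]; dtac.
have HT b1 b2 : funion (@piece n.+1) (D `&` @init _ M n @^-1` T b1 b2).
  apply: part => // V oV VT.
  have lowV : (forall x, V x -> low_end x) \/ (forall x, V x -> ~ low_end x).
    by case: b2 VT => VT; [left|right] => x /VT [_ []].
  case: b1 VT => VT.
    by apply: over_nonempty => // x /VT [? []].
  by apply: over_empty => // x /VT [? []].
have Hbad : funion (@piece n.+1) (D `&` @init _ M n @^-1` (fun x => ~ good x)).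
  apply: part; first exact: dset_not dset_good.
  by move=> V oV /(empty_type oV)->; rewrite preimage_set0 setI0; apply: funion0.
have -> : D = (D `&` @init _ M n @^-1` (fun x => ~ good x)) `|`
   ((D `&` @init _ M n @^-1` T true true) `|` (D `&` @init _ M n @^-1` T true false) `|`
    ((D `&` @init _ M n @^-1` T false true) `|` (D `&` @init _ M n @^-1` T false false))).
  apply/seteqP; split=> z /=; last by rewrite /T /=; tauto.
  move=> Dz; have [gz|bz] := pselect (good (init z)); last by left.
  right; rewrite /T /=.
  by have [h1|h1] := pselect (has_bd (init z)); have [h2|h2] := pselect (low_end (init z)); tauto.
by do !apply: funion_setU.
Qed.

End Fibres.

Theorem decomposition n (X : set (pt n)) : dset S X -> funion (@piece n) X.
Proof.
elim: n X => [|n IH] X dX.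
  have [[x Xx]|no] := pselect (exists x, X x).
    have -> : X = setT by apply/seteqP; split=> // y _; rewrite (pt0_eq y x).
    by apply: funion1; split; [apply: dset_cst|left; apply: ocell0].
  rewrite (_ : X = set0); first exact: funion0.
  by apply/seteqP; split=> // y Xy; apply: no; exists y.
have dA := dset_fibre_bd dX.
have [|next dnext nextP] := choice1 HS m0 (P := fun z t => is_next X z t).
  by rewrite /is_next; dtac.
have [|least dleast leastP] := choice1 HS m0 (P := fun x t => fibre_bd X (app_last x t) /\
    forall s, s < t -> ~ fibre_bd X (app_last x s)).
  by dtac.
have [c m0c] := lto_succ HM true m0.
apply: (@fibres_decomposition n X dX next least c) => //.
  by move=> z hz; apply: nextP; apply: has_nextP.
by move=> x ne; apply: leastP; apply: fin_min => //; apply: fin_fibre_bd.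
Qed.

End Decomposition.

(** * Covering open sets *)

Section Covering.
Variables (d : Order.disp_t) (M : orderType d) (HM : DLO_no_endpoints M).
Variables (S : ominimal_structure M) (HS : definable_choice S) (m0 : M).
Local Notation pt := (pt M).

Lemma near_reindex k n (s : 'I_k -> 'I_n) (x : pt n) (P : pt k -> Prop) : injective s ->
  near (fun j => x (s j)) P -> near x (fun y => P (fun j => y (s j))).
Proof.
move=> sI [a [b [abx H]]].
have [a0 [b0 [abx0 _]]] := near_all HM x (fun _ => I).
(* A box of [M^k] becomes a box of [M^n]: coordinates outside the range of [s] are bounded by an
   arbitrary box around [x]. *)
pose ext (c : pt k) (c0 : pt n) : pt n := fun i => if [pick j | s j == i] is Some j then c j else c0 i.
have extE c c0 j : ext c c0 (s j) = c j.
  by rewrite /ext; case: pickP => [j' /eqP/sI-> //|/(_ j)]; rewrite eqxx.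
exists (ext a a0), (ext b b0); split.
  move=> i; rewrite /ext; case: pickP => [j /eqP <-|_]; [exact: abx|exact: abx0].
by move=> y aby; apply: H => j; have := aby (s j); rewrite !extE.
Qed.

Definition base k n (le : (k <= n)%N) (z : pt n) : pt k := fun i => z (widen_ord le i).

Lemma base_id k (le : (k <= k)%N) (z : pt k) : base le z = z.
Proof. by apply/funext => i; congr z; apply: val_inj. Qed.

Lemma base_init k n (le : (k <= n.+1)%N) (le' : (k <= n)%N) (z : pt n.+1) :
  base le z = base le' (init z).
Proof.
apply/funext => i; congr z; apply: val_inj => /=.
by rewrite /bump leqNgt (leq_trans (ltn_ord i) le').
Qed.

Lemma dmap_base k n (le : (k <= n)%N) : dmap S (base le).
Proof. by move=> i; apply: deff_coord. Qed.

Lemma cont_base k n (le : (k <= n)%N) (f : pt k -> M) x :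
  cont_at f (base le x) -> cont_at (fun y => f (base le y)) x.
Proof.
move=> cf p q px xq; have := cf p q px xq.
by apply: near_reindex => i j /(congr1 val) /= /val_inj.
Qed.

(** Boxes in the coordinates from [k] on, varying over [C]. The bounds depend only on the first [k]
    coordinates and are indexed by [nat], so that the same families serve for every [n]. *)
Definition tower k n (le : (k <= n)%N) (C : set (pt k)) (g h : nat -> pt k -> M) : set (pt n) :=
  [set z | C (base le z) /\ forall i : 'I_n, (k <= i)%N ->
             g i (base le z) < z i /\ z i < h i (base le z)].

Lemma tower_id k (le : (k <= k)%N) (C : set (pt k)) g h : tower le C g h = C.
Proof.
apply/seteqP; split=> z; rewrite /tower /= base_id; first by case.
by move=> Cz; split=> // i; rewrite leqNgt ltn_ord.
Qed.

Lemma ocell_tower k (C : set (pt k)) (g h : nat -> pt k -> M) : ocell S C ->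
  (forall i, bound S C (Some (g i)) /\ bound S C (Some (h i))) ->
  forall n (le : (k <= n)%N),
  (forall x i, C x -> (k <= i < n)%N -> g i x < h i x) -> ocell S (tower le C g h).
Proof.
move=> oC bgh; elim=> [|n IH] le gh.
  have e : k = 0%N by apply/eqP; rewrite -leqn0.
  by subst k; rewrite tower_id.
have [e|ne] := eqVneq k n.+1; first by subst k; rewrite tower_id.
have le' : (k <= n)%N by rewrite -ltnS ltn_neqAle ne.
have oT : ocell S (tower le' C g h).
  by apply: IH => x i Cx /andP[ki ik]; apply: gh => //; rewrite ki ltnW.
pose g' y := g n (base le' y); pose h' y := h n (base le' y).
have db := @dmap_base k n le'.
have -> : tower le C g h = band (tower le' C g h) (Some g') (Some h').
  apply/seteqP; split=> z; rewrite /tower /band /= (base_init le le').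
    move=> [Cz H]; split; last exact: (H ord_max).
    split=> // i ki; have := H (lift ord_max i).
    by rewrite lift_max; apply.
  move=> [[Cz H] Hn]; split=> // i ki.
  case: (unliftP ord_max i) ki => [j|] ->; last by [].
  by rewrite lift_max => kj; apply: H.
apply: ocell_band => //.
- have [[dg cg] _] := bgh n; split; first exact: deff_comp dg db.
  by move=> x [Cx _]; apply: cont_base; apply: cg.
- have [_ [dh ch]] := bgh n; split; first exact: deff_comp dh db.
  by move=> x [Cx _]; apply: cont_base; apply: ch.
- by move=> x [Cx _]; apply: gh => //; rewrite le' leqnn.
Qed.

Definition nice n (U V : set (pt n)) : Prop :=
  [/\ dset S V, open_set V, V `<=` U &
      exists s : {perm 'I_n}, open_cell S ((fun x : pt n => x \o s) @` V)].

(** The covering set may leave [X] but its members stay in [U]. Hence it suffices to cover the parts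
    of [X] separately, however thin they are. *)
Definition covered n (U X : set (pt n)) : Prop :=
  exists2 W, X `<=` W & funion (nice U) W.

Lemma covered_setU n (U X Y : set (pt n)) : covered U X -> covered U Y -> covered U (X `|` Y).
Proof.
move=> [W XW fW] [Z YZ fZ]; exists (W `|` Z); last exact: funion_setU.
by move=> x [/XW|/YZ]; [left|right].
Qed.

Lemma covered_sub n (U X Y : set (pt n)) : X `<=` Y -> covered U Y -> covered U X.
Proof. by move=> XY [W YW fW]; exists W => // x /XY/YW. Qed.

Lemma covered_preimage n T (U X : set (pt n)) (f : pt n -> T) P Y : funion P Y ->
  (forall V, P V -> V `<=` Y -> covered U (X `&` f @^-1` V)) -> covered U (X `&` f @^-1` Y).
Proof.
elim=> [|Z V _ IH PV] H.
  by exists set0; [move=> x []|apply: funion0].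
rewrite preimage_setU setIUr; apply: covered_setU.
  by apply: IH => W PW WZ; apply: H => // x /WZ; left.
by apply: H => // x; right.
Qed.

Lemma covered_perm n (s : {perm 'I_n}) (U X : set (pt n)) :
  covered [set x : pt n | U (x \o s)] [set x : pt n | X (x \o s)] -> covered U X.
Proof.
pose r := (s^-1)%g.
have rK (x : pt n) : (x \o r) \o s = x by apply/funext => i /=; rewrite permK.
have sK (x : pt n) : (x \o s) \o r = x by apply/funext => i /=; rewrite permKV.
move=> [W XW fW]; exists ([set: pt n] `&` (fun x : pt n => x \o r) @^-1` W).
  by move=> x Xx; split=> //; apply: XW; rewrite /= rK.
apply: funion_preimage fW _ => V [dV oV VU [t ct]] _; rewrite setTI.
apply: funion1; split.
- exact: (dset_reindex r dV).
- move=> x Vx; have := oV _ Vx; apply: (near_reindex (s := r)).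
  exact: perm_inj.
- by move=> x /VU; rewrite /= rK.
- exists (t * r)%g; move: ct; congr open_cell; apply/seteqP; split=> y /= [x Vx <-].
    exists (x \o s); first by rewrite /preimage /= sK.
    by apply/funext => i /=; rewrite permM permKV.
  by exists (x \o r) => //; apply/funext => i /=; rewrite permM.
Qed.

Definition determined k n (le : (k <= n)%N) (X : set (pt n)) : Prop :=
  forall x y, X x -> X y -> base le x = base le y -> x = y.

(* Choose definably, for each point of [X], a box around it inside [U] as a function of its
   first [k] coordinates; over an open cell on which this choice is continuous the boxes
   form an open cell. *)
Lemma covered_modulo_thin k n (le : (k <= n)%N) (U X : set (pt n)) :
  dset S U -> open_set U -> dset S X -> X `<=` U -> determined le X ->
  (forall V, dset S V -> thin V -> covered U (X `&` base le @^-1` V)) -> covered U X.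
Proof.
move=> dU oU dX XU detX Hthin.
have db := dmap_base le.
pose P (a : pt k) (w : pt (n + n)) := exists z, X z /\ base le z = a /\
  box (fstc w) (sndc w) z /\ forall y, box (fstc w) (sndc w) y -> U y.
have [|f df Hf] := choicev HS m0 (P := P).
  by rewrite /P; cbv beta delta [box mkset]; dtac.
pose D : set (pt k) := [set a | exists z, X z /\ base le z = a].
have dD : dset S D by rewrite /D; cbv beta delta [mkset]; dtac.
have {}Hf a : D a -> P a (f a).
  move=> [z [Xz za]]; apply: Hf; have [l [u [luz H]]] := oU z (XU z Xz).
  by exists (cat_pt l u); exists z; rewrite fstc_cat sndc_cat.
pose K a := forall i, cont_at (fun b => f b i) a.
have dK : dset S K.
  rewrite /K; apply: dset_all_ord => i; have dfi := df i.
  pose fi b := f b i; have dfi' : deff S fi := dfi.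
  by rewrite -[fun b => f b i]/fi; cbv beta delta [cont_at near box mkset]; dtac.
have gK : generic K.
  by apply: generic_all_ord => i; apply: (generic_continuity HM HS m0).
apply: (@covered_sub _ _ _ ((X `&` base le @^-1` [set a | D a /\ K a]) `|`
                          (X `&` base le @^-1` [set a | D a /\ ~ K a]))).
  move=> x Xx; have Dx : D (base le x) by exists x.
  by have [Kx|Kx] := pselect (K (base le x)); [left|right].
apply: covered_setU.
  apply: covered_preimage (decomposition HM HS m0 (dset_and dD dK)) _.
  move=> V [dV [oV|tV]] VD; last exact: Hthin.
  (* A value of [f] lists the lower corner of the box, then the upper one; [m0] fills the indices
     beyond [n]. *)
  pose g (j : nat) (a : pt k) := if insub j is Some i then f a (lshift n i) else m0.
  pose h (j : nat) (a : pt k) := if insub j is Some i then f a (rshift n i) else m0.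
  have cst : bound S V (Some (fun _ => m0)).
    split; first exact: deff_cst.
    by move=> x _ p q px xq; apply: near_all.
  have oT : ocell S (tower le V g h).
    apply: ocell_tower => //.
      move=> i; rewrite /g /h; case: insubP => [j _ _|_] //.
      by split; split=> [|x /VD[_]]; [apply: df|apply|apply: df|apply].
    move=> x i /VD[/Hf[z [Xz [zx [bz _]]]] _] /andP[ki ik].
    rewrite /g /h insubT /=; have [h1 h2] := bz (Ordinal ik).
    exact: lt_trans h2.
  (* The box chosen over [base le z] surrounds some point of [X] with the same base; since [X] is
     determined by its base, that point is [z]. *)
  have inside z : V (base le z) -> X z -> tower le V g h z.
    move=> Vz Xz; split=> // i ki; have [/Hf[y [Xy [yz [by_ _]]]] _] := VD _ Vz.
    by rewrite (detX _ _ Xy Xz yz) in by_; rewrite /g /h valK; apply: by_.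
  exists (tower le V g h); first by move=> z [Xz Vz]; apply: inside.
  apply: funion1; split.
  - exact: ocell_dset.
  - by move=> x /(ocell_open HM oT).
  (* [z] lies in the chosen box around [y]: its first [k] coordinates are those of [y], and the
     others obey the bounds of the tower. *)
  - move=> z [Vz Tz]; have [/Hf[y [Xy [yz [by_ HU]]]] _] := VD _ Vz; apply: HU => i.
    have [ki|ik] := leqP k i; first by have := Tz i ki; rewrite /g /h valK.
    have -> : z i = y i; last exact: by_.
    have := congr1 (fun c => c (Ordinal ik)) yz; rewrite /base.
    by rewrite (_ : widen_ord le _ = i) //; apply: val_inj.
  exists 1%g; rewrite (_ : _ @` _ = tower le V g h); first exact: ocell_open_cell.
  have E (x : pt n) : x \o (1%g : {perm 'I_n}) = x by apply/funext => i /=; rewrite perm1.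
  by apply/seteqP; split=> y => [[x Tx <-]|Ty]; [rewrite E|exists y].
(* Where the choice is discontinuous only thin pieces matter: a nonempty open cell would meet
   [K]. *)
apply: covered_preimage (decomposition HM HS m0 (dset_and dD (dset_not dK))) _.
move=> V [dV [oV|tV]] VD; last exact: Hthin.
exists set0; last exact: funion0.
move=> x [_ Vx]; have [y Hy] := gK _ _ (ocell_open HM oV Vx).
by have [Ky /VD[_]] := near_self Hy.
Qed.

Lemma determined_covered k n (le : (k <= n)%N) (U X : set (pt n)) :
  dset S U -> open_set U -> dset S X -> X `<=` U -> determined le X -> covered U X.
Proof.
elim: k n le U X => [|k IH] n le U X dU oU dX XU detX;
  apply: (covered_modulo_thin dU oU dX XU detX) => V dV [i thinV]; first by case: i thinV.
pose w := widen_ord le.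
pose s := tperm (w i) (w ord_max).
apply: (covered_perm (s := s)); apply: (IH n (ltnW le)).
- exact: (dset_reindex s dU).
- move=> x Ux; have := oU _ Ux; apply: (near_reindex (s := s)).
  exact: perm_inj.
- have db := dmap_base le.
  have dY : dset S (fun z => X z /\ V (base le z)) by dtac.
  exact: (dset_reindex s dY).
- by move=> x [/XU].
move=> x y [Xx Vx] [Xy Vy] exy.
suff /(congr1 (fun z : pt n => z \o s)) : x \o s = y \o s.
  have E (z : pt n) : (z \o s) \o s = z by apply/funext => j /=; rewrite tpermK.
  by rewrite /= !E.
apply: detX => //; apply: thinV => // j ji; rewrite /base /=.
have small (l : 'I_n) : (l < k)%N -> x l = y l.
  move=> lk; have := congr1 (fun c => c (Ordinal lk)) exy.
  by rewrite /base (_ : widen_ord _ _ = l) //; apply: val_inj.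
have wI : injective w by move=> a b /(congr1 val) /= /val_inj.
(* The transposition sends the last index to [i], which is not last because [j != i], and fixes
   every other [j]; in both cases the resulting index is below [k]. *)
have [jm|jm] := eqVneq j ord_max.
  rewrite jm /s tpermR; apply: small; have := ltn_ord i; rewrite ltnS leq_eqVlt => /orP[/eqP e|//].
  by case/eqP: ji; rewrite jm; apply: val_inj.
rewrite /s tpermD; last by rewrite (inj_eq wI) eq_sym.
  apply: small; have := ltn_ord j; rewrite ltnS leq_eqVlt => /orP[/eqP e|//].
  by case/eqP: jm; apply: val_inj.
by rewrite (inj_eq wI) eq_sym.
Qed.

End Covering.

(** * Indexed unions and the conclusion *)

Lemma funion_family T (P : set T -> Prop) X : funion P X ->
  exists k (V : 'I_k -> set T), X = \bigcup_(i in [set: 'I_k]) V i /\ forall i, P (V i).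
Proof.
elim=> [|Y W _ [k [V [-> PV]]] PW].
  exists 0%N, (fun _ => set0); split; last by case.
  by apply/seteqP; split=> // x [[]].
exists k.+1, (fun i => if unlift ord_max i is Some j then V j else W); split; last first.
  by move=> i; case: (unlift _ i).
apply/seteqP; split=> x.
  move=> [[j _ Vx]|Wx]; first by exists (lift ord_max j) => //; rewrite liftK.
  by exists ord_max => //; rewrite unlift_none.
move=> [i _]; case: (unlift _ i) => [j Vx|Wx]; last by right.
by left; exists j.
Qed.

Theorem theorem2p2 (d : Order.disp_t) (M : orderType d)
  (HM : DLO_no_endpoints M) (S : ominimal_structure M)
  (HS : definable_choice S) (n : nat) (U : set (pt M n)) :
  Def S n U -> open_set U ->
  exists (k : nat) (V : 'I_k -> set (pt M n)) (sigma : 'I_k -> {perm 'I_n}),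
    U = \bigcup_(i in [set: 'I_k]) V i /\
    forall i, Def S n (V i) /\ open_set (V i) /\
      open_cell S ((fun x : pt M n => x \o sigma i) @` V i).
Proof.
move=> dU oU.
suff fU : funion (nice S U) U.
  have [k [V [UV nV]]] := funion_family fU.
  have [s Hs] := choice (fun i => let: And4 _ _ _ h := nV i in h).
  by exists k, V, s; split=> // i; have [dV oV _ _] := nV i.
(* The choice lemmas need a point of [M]. In dimension zero none may exist, and the only nonempty
   set is itself a cell; in positive dimension a point of [U] supplies one as its first
   coordinate. *)
case: n U dU oU => [|n] U dU oU.
  have [[x Ux]|no] := pselect (exists x, U x); last first.
    rewrite (_ : U = set0); first exact: funion0.
    by apply/seteqP; split=> // y Uy; apply: no; exists y.
  have UT : U = setT by apply/seteqP; split=> // y _; rewrite (pt0_eq y x).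
  apply: funion1; split=> //; exists 1%g; exists [::]; split=> //.
  rewrite (_ : _ @` _ = setT); first exact: cell_pt.
  by apply/seteqP; split=> // y _; exists x => //; apply: pt0_eq.
have [[x Ux]|no] := pselect (exists x, U x); last first.
  rewrite (_ : U = set0); first exact: funion0.
  by apply/seteqP; split=> // y Uy; apply: no; exists y.
have [||W UW fW] := @determined_covered _ _ HM S HS (x ord0) _ _ (leqnn n.+1) U U dU oU dU.
- by [].
- by move=> y z _ _; rewrite !base_id.
(* The members of the covering family lie in [U], so the covering is an equality. *)
suff WU : W `<=` U by rewrite {2}(_ : U = W) //; apply/seteqP.
by elim: fW => // Y V _ IH [_ _ VU _] y [/IH|/VU].
Qed.
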